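(* Every connected outerplanar graph $G$ that is not isomorphic to the $5$-cycle $C_5$ is proper conflict-free $({\rm degree}+2)$-choosable.
   Context: All graphs are simple, finite and undirected. $\mathbb{N}$ is the set of positive integers; $N_G(v)$ is the open neighborhood of $v$ in $G$ and $d_G(v)$ its degree. A proper coloring of $G$ is a map $\phi:V(G)\to\mathbb{N}$ with $\phi(u)\neq\phi(v)$ for every edge $uv\in E(G)$. A proper conflict-free coloring of $G$ is a proper coloring $\phi$ of $G$ such that for every non-isolated vertex $v\in V(G)$ there is a color $c$ with $|\phi^{-1}(c)\cap N_G(v)|=1$. A list assignment $L$ of $G$ is a map from $V(G)$ to the power set of $\mathbb{N}$. A proper conflict-free $L$-coloring of $G$ is a proper conflict-free coloring $\phi$ of $G$ with $\phi(v)\in L(v)$ for every $v\in V(G)$. For a non-negative integer $k$, $G$ is proper conflict-free $({\rm degree}+k)$-choosable if $G$ admits a proper conflict-free $L$-coloring for every list assignment $L$ of $G$ satisfying $|L(v)|\geq d_G(v)+k$ for every $v\in V(G)$. A graph is outerplanar if it has a planar embedding with all vertices on the boundary of the outer face. *)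

(* Defs.v *)
From mathcomp Require Import all_boot all_order all_algebra.
From mathcomp Require Import all_classical all_reals all_analysis.

Set Implicit Arguments.
Unset Strict Implicit.
Unset Printing Implicit Defensive.

Import Order.TTheory GRing.Theory Num.Theory.
Import numFieldNormedType.Exports.

Record sgraph := SGraph {
  vertex :> finType;
  adj : rel vertex;
  adj_sym : symmetric adj;
  adj_irrefl : irreflexive adj }.

Definition neigh (G : sgraph) (v : G) : {set G} := [set w | adj v w]%SET.

Definition degree (G : sgraph) (v : G) : nat := #|neigh v|.

Definition connected_graph (G : sgraph) : Prop :=
  forall u v : G, connect (@adj G) u v.

Definition graph_iso (G H : sgraph) : Prop :=
  exists2 f : G -> H, bijective f & forall u v : G, adj (f u) (f v) = adj u v.

Definition C5_adj : rel 'I_5 := [rel i j | (j == ordS i) || (i == ordS j)].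

Lemma C5_adj_sym : symmetric C5_adj.
Proof. by move=> i j; rewrite /= [RHS]orbC. Qed.

Lemma C5_adj_irrefl : irreflexive C5_adj.
Proof. by case=> [[|[|[|[|[|n]]]]] lt_n5]. Qed.

Definition C5 : sgraph := SGraph C5_adj_sym C5_adj_irrefl.

Notation color := {n : nat | (0 < n)%N}.

Definition proper_coloring (G : sgraph) (phi : G -> color) : Prop :=
  forall u v : G, adj u v -> phi u <> phi v.

Definition proper_conflict_free (G : sgraph) (phi : G -> color) : Prop :=
  proper_coloring phi /\
  forall v : G, (0 < degree v)%N ->
    exists c : color, #|(phi @^-1: pred1 c :&: neigh v)%SET| = 1%N.

(* Lists may be infinite, so their size is compared with a number through an
   injection of {0, ..., n - 1}. *)
Definition pcf_degree_choosable (k : nat) (G : sgraph) : Prop :=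
  forall L : G -> set color,
    (forall v : G, (`I_(degree v + k) #<= L v)%card) ->
    exists2 phi : G -> color,
      proper_conflict_free phi & forall v : G, L v (phi v).

Section Outerplanar.
Local Open Scope classical_set_scope.
Local Open Scope ring_scope.
Variables (R : realType) (G : sgraph).

Definition boundary (T : topologicalType) (A : set T) : set T :=
  closure A `\` interior A.

(* The edge uv is drawn as the simple arc t |-> arc u v t, for t in [0, 1]; both
   orientations of an edge must trace the same arc.  The values of arc u v for
   non-adjacent u and v are irrelevant. *)
Record planar_embedding (pos : G -> R * R) (arc : G -> G -> R -> R * R) : Prop :=
  PlanarEmbedding {
    pos_inj : injective pos;
    arc_continuous : forall u v, adj u v ->
      {within `[0, 1], continuous (arc u v)};
    arc_inj : forall u v, adj u v -> {in `[0, 1] &, injective (arc u v)};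
    arc_source : forall u v, adj u v -> arc u v 0 = pos u;
    arc_target : forall u v, adj u v -> arc u v 1 = pos v;
    arc_sym : forall u v, adj u v -> arc u v @` `[0, 1] = arc v u @` `[0, 1];
    arc_avoids_vertices : forall u v w, adj u v ->
      ~ (arc u v @` `]0, 1[) (pos w);
    arc_disjoint : forall u v x y, adj u v -> adj x y ->
      [set u; v]%SET <> [set x; y]%SET ->
      arc u v @` `]0, 1[ `&` arc x y @` `]0, 1[ = set0 }.

Definition drawing (pos : G -> R * R) (arc : G -> G -> R -> R * R) :
    set (R * R) :=
  range pos `|`
  \bigcup_(e in [set e : G * G | adj e.1 e.2]) (arc e.1 e.2 @` `[0, 1]).

(* For a bounded S, such as the drawing of a finite graph, there is exactly one
   such F. *)
Definition outer_face (S F : set (R * R)) : Prop :=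
  (exists2 x, ~ S x & F = connected_component (~` S) x) /\ ~ bounded_set F.

Definition outerplanar : Prop :=
  exists (pos : G -> R * R) (arc : G -> G -> R -> R * R),
    planar_embedding pos arc /\
    exists2 F, outer_face (drawing pos arc) F &
      forall v : G, boundary F (pos v).

End Outerplanar.

(* Main.v *)
Require Import Defs.
From mathcomp Require Import all_boot all_order all_algebra.
From mathcomp Require Import zify.
From mathcomp Require boolp.

Set Implicit Arguments.
Unset Strict Implicit.
Unset Printing Implicit Defensive.

(** Why the theorem is true.

    Excluded minors.  If an outerplanar graph had a K_{2,3} or a K_4 minor, a
    point z of the outer face could be joined to every branch set, since each
    of them contains a vertex and all vertices lie on the boundary of the face.
    The result is a drawing of K_{3,3} or K_5 in which every edge is a
    continuum (a compact connected set) and independent edges are disjoint.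
    No such drawing exists, and the Jordan curve theorem is not needed to see
    it.  Follow two independent edges e and f by fine chains of points: the
    vector from a point of e to a point of f never vanishes, so its winding
    number around the boundary of the rectangle e x f is zero
    ([winding_rectangle]).  Counted in quarter turns, this is a relation
    between integers attached to pairs (vertex, edge) ([crossing_relation]).
    Summed over all pairs of independent edges of K_5 or of K_{3,3}, every
    integer occurs an even number of times while the constant is odd: it is
    the number of crossings of a drawing with the vertices on a circle.  This
    gives [outerplanar_theta_free] and [outerplanar_K4_free], the only facts
    about the plane that are used.

    Colouring.  Colour the graph from a cycle outwards.  A coloured vertex p
    whose neighbourhood already has a colour occurring exactly once keeps this
    colour as its witness c p; neighbours coloured later avoid c p.  A
    connected piece K of the uncoloured part is attached to the coloured part
    either at one vertex (it hangs there) or at the two ends of an edge (it is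
    wedged there).  Two statements are proved together by induction on the
    size of K ([pieces_extendable]):
    - a hanging piece can always be coloured;
    - for a piece wedged at ab, once the colours of a and b and the witness of
      a are fixed, at most one choice of the witness of b is bad.

    For the induction step ([wedged_step], [hanging_step]) choose a chordless
    path through K and close it up to a cycle.  By the excluded minors, each
    component of the rest of K hangs at a vertex of the cycle or is wedged at
    one of its edges, with at most one component per edge ([ring_touch],
    [ring_touch_unique]).  Colour the cycle properly and so that the two
    neighbours of each new vertex differ.  Each new vertex may then take as
    witness the colour of either of its two neighbours on the cycle; of these
    two options at most one is bad for a given component wedged there.  So the
    edges can be served one after another, from both ends of the path up to an
    edge with no component ([pinned_choice]).  If every edge of the path carries a
    component, all inner vertices have degree at least four, and their lists of
    six colours leave room to colour the path in a way that suits both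
    candidates for the witness of b.  For a hanging piece, and for the first
    cycle of all, the cycle is taken through a smallest possible wedged set, so
    that it has an edge with no component.

    Each cycle is coloured greedily or by a short list colouring argument
    ([word_around], [word_cycle]).  The only obstruction is a first cycle of
    length five, whose vertices need five distinct colours: lists of size four
    may fail, but one vertex of degree at least three suffices, and without it
    the whole graph is C_5 ([five_ring_C5]). *)

(** * Connected vertex sets and their components *)

Section ConnectedSets.
Variable G : sgraph.
Implicit Types (u v x y : G) (A B D K : {set G}) (s : seq G).

Definition adj_in K : rel G := [rel x y | [&& x \in K, y \in K & adj x y]].

Definition connected_in K : Prop :=
  forall u v, u \in K -> v \in K -> connect (adj_in K) u v.

Definition touches K v := [exists w in K, adj v w].

Lemma touchesP K v : reflect (exists2 w, w \in K & adj v w) (touches K v).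
Proof. exact: exists_inP. Qed.

Lemma adjC u v : adj u v = adj v u.
Proof. exact: adj_sym. Qed.

Lemma adj_neq u v : adj u v -> u != v.
Proof. by apply: contraTneq => ->; rewrite adj_irrefl. Qed.

Lemma adj_in_sym K : symmetric (adj_in K).
Proof. by move=> x y; rewrite /adj_in /= adjC andbCA. Qed.

Lemma connect_inC K : connect_sym (adj_in K).
Proof. exact/sym_connect_sym/adj_in_sym. Qed.

Lemma connected_in1 v : connected_in [set v].
Proof. by move=> x y /set1P-> /set1P->. Qed.

Lemma adj_in_subset A B : A \subset B -> subrel (adj_in A) (adj_in B).
Proof. by move=> /subsetP AB x y /and3P[/AB xB /AB yB xy]; apply/and3P. Qed.

Lemma connect_in_subset A B u v : A \subset B ->
  connect (adj_in A) u v -> connect (adj_in B) u v.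
Proof.
move=> AB; apply: connect_sub => x y xy; apply: connect1.
exact: adj_in_subset AB _ _ xy.
Qed.

Lemma connected_inU A B x y : connected_in A -> connected_in B ->
  x \in A -> y \in B -> (x == y) || adj x y -> connected_in (A :|: B).
Proof.
move=> cA cB xA yB xy.
have AU : A \subset A :|: B by exact: subsetUl.
have BU : B \subset A :|: B by exact: subsetUr.
have to_x u : u \in A :|: B -> connect (adj_in (A :|: B)) x u.
  case/setUP => [uA|uB].
    by apply: connect_in_subset AU _; apply: cA.
  have yu : connect (adj_in (A :|: B)) y u.
    by apply: connect_in_subset BU _; apply: cB.
  case/orP: xy => [/eqP->//|xy]; apply: connect_trans yu; apply: connect1.
  by rewrite /adj_in /= (subsetP AU) ?(subsetP BU).
move=> u v /to_x xu /to_x xv; apply: connect_trans xv.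
by rewrite connect_inC.
Qed.

Lemma connected_in_path x s : path (@adj G) x s -> connected_in [set y in x :: s].
Proof.
elim: s x => [|y s IH] x /=.
  by move=> _ u v; rewrite !inE => /eqP-> /eqP->.
move=> /andP[xy ys].
have -> : [set z in [:: x, y & s]] = [set x] :|: [set z in y :: s].
  by apply/setP => z; rewrite !inE.
apply: (@connected_inU _ _ x y (connected_in1 (v:=x)) (IH y ys)).
- by rewrite inE.
- by rewrite !inE eqxx.
- by rewrite xy orbT.
Qed.

(** A walk in A starting in D cannot leave D. *)
Lemma connected_in_trapped A D : connected_in A ->
  (forall u v, u \in A :&: D -> v \in A -> adj u v -> v \in D) ->
  A :&: D != set0 -> A \subset D.
Proof.
move=> cA stay /set0Pn[x /setIP[xA xD]]; apply/subsetP => y yA.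
have /connectP[p] := cA x y xA yA.
elim: p x xA xD => [|z p IH] x xA xD /=; first by move=> _ ->.
move=> /andP[/and3P[_ zA xz] zp]; apply: IH zp => //.
by apply: stay xz; rewrite // inE xA.
Qed.

Definition component K v := [set w in K | connect (adj_in K) v w].

Lemma component_sub K v : component K v \subset K.
Proof. by apply/subsetP => w; rewrite inE => /andP[]. Qed.

Lemma component_self K v : v \in K -> v \in component K v.
Proof. by move=> vK; rewrite inE vK connect0. Qed.

Lemma component_closed K v u w : u \in component K v -> w \in K -> adj u w ->
  w \in component K v.
Proof.
rewrite !inE => /andP[uK vu] wK uw; rewrite wK; apply: connect_trans vu _.
by apply: connect1; rewrite /adj_in /= uK wK.
Qed.

Lemma connected_in_component K v : connected_in (component K v).
Proof.
have down u : u \in component K v ->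
    connect (adj_in (component K v)) v u.
  rewrite inE => /andP[uK /connectP[p]].
  elim/last_ind: p u uK => [|p z IH] u uK /=; first by move=> _ ->.
  rewrite rcons_path last_rcons => /andP[vp lz] ->.
  have /and3P[lK zK ladj] := lz.
  have vl : connect (adj_in K) v (last v p) by apply/connectP; exists p.
  apply: connect_trans (IH _ lK vp erefl) _; apply: connect1.
  rewrite /adj_in /= !inE lK zK vl ladj !andbT /=.
  by apply: connect_trans vl (connect1 lz).
by move=> x y /down vx /down vy; apply: connect_trans vy; rewrite connect_inC.
Qed.

Lemma component_eq K v w : w \in component K v -> component K w = component K v.
Proof.
rewrite inE => /andP[wK vw]; apply/setP => x; rewrite !inE.
by rewrite (same_connect (connect_inC K) vw).
Qed.

End ConnectedSets.

Section ForbiddenMinors.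
Variable G : sgraph.

(** Q is a branch set that can serve as an inner path between a and b. *)
Definition spans (a b : G) (Q : {set G}) : Prop :=
  [/\ connected_in Q, a \notin Q, b \notin Q, touches Q a & touches Q b].

(** No K_{2,3} minor whose two branch sets on the small side are single
    vertices; this special case is all that the colouring needs. *)
Definition theta_free : Prop := forall (a b : G) (Q1 Q2 Q3 : {set G}),
  a != b -> spans a b Q1 -> spans a b Q2 -> spans a b Q3 ->
  [disjoint Q1 & Q2] -> [disjoint Q1 & Q3] -> [disjoint Q2 & Q3] -> False.

(** No K_4 minor in which three branch sets are single vertices. *)
Definition K4_free : Prop := forall (u v w : G) (Q : {set G}),
  adj u v -> adj v w -> adj u w -> connected_in Q ->
  u \notin Q -> v \notin Q -> w \notin Q ->
  touches Q u -> touches Q v -> touches Q w -> False.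

Lemma connected_in_touch (v : G) (Q : {set G}) :
  connected_in Q -> touches Q v -> connected_in ([set v] :|: Q).
Proof.
move=> cQ /touchesP[w wQ vw].
apply: (connected_inU (connected_in1 (v := v)) cQ (x := v) (y := w)) => //.
  by rewrite inE.
by rewrite vw orbT.
Qed.

Lemma connected_in_adj (u v : G) : adj u v -> connected_in ([set u] :|: [set v]).
Proof.
move=> uv; apply: connected_in_touch; first exact: connected_in1.
by apply/touchesP; exists v; rewrite ?inE.
Qed.

End ForbiddenMinors.

(** * Chordless paths *)

(** The length of a sequence of vertices occurs at several convertible types
    of elements; it is abstracted so that arithmetic sees a single unknown. *)
Ltac lia_size s :=
  let m := fresh "m" in
  pose m := size s;
  repeat match goal with
  | |- context [@size ?T s] => change (@size T s) with m
  | H : context [@size ?T s] |- _ => change (@size T s) with m in H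
  end; clearbody m; lia.

Section InducedPath.
Variables (G : sgraph) (K : {set G}) (a b : G).
Implicit Types (s : seq G).

Definition path_through s : Prop :=
  [/\ s != [::], {subset s <= K} & path (@adj G) a (rcons s b)].

(** The pair formed by the two ends is exempt: a and b may be adjacent. *)
Definition induced_path s : Prop := forall i j,
  i.+1 < j <= (size s).+1 -> (i != 0) || (j != (size s).+1) ->
  ~~ adj (nth a (a :: rcons s b) i) (nth a (a :: rcons s b) j).

Lemma shortcut s i j : path_through s -> i.+1 < j <= (size s).+1 ->
  (i != 0) || (j != (size s).+1) ->
  adj (nth a (a :: rcons s b) i) (nth a (a :: rcons s b) j) ->
  path_through (take i s ++ drop j.-1 s).
Proof.
move=> [s0 sK ps] /andP[ij js] ij0 aij; split.
- by rewrite -size_eq0 -lt0n size_cat size_takel ?size_drop; lia_size s.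
- by move=> x; rewrite mem_cat => /orP[/mem_take|/mem_drop]; exact: sK.
have is_ : i <= size s by lia_size s.
have lastE : last a (take i s) = nth a (a :: rcons s b) i.
  clear ij ij0 aij; move: is_; case: i => [|i] is_ /=; first by rewrite take0.
  by rewrite nth_rcons is_ (last_nth a) size_takel//= nth_take.
have dropE : rcons (drop j.-1 s) b =
    nth a (a :: rcons s b) j :: drop j (rcons s b).
  rewrite -drop_rcons; last by lia_size s.
  rewrite (drop_nth a) ?size_rcons; last by lia_size s.
  by clear js ij0 aij; case: j ij.
rewrite rcons_cat dropE cat_path /= lastE aij /=.
have psi : path (@adj G) a (take i s).
  by move: ps; rewrite -{1}(cat_take_drop i s) rcons_cat cat_path => /andP[].
rewrite psi /=.
move: ps; rewrite -{1}(cat_take_drop j (rcons s b)) cat_path => /andP[_].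
suff -> : last a (take j (rcons s b)) = nth a (a :: rcons s b) j by [].
rewrite (last_nth a) size_takel ?size_rcons//.
by clear js ij0 aij dropE; case: j ij => // j _ /=; rewrite nth_take.
Qed.

(** Shortcuts along chords make the path shorter, so they come to an end. *)
Lemma induced_path_exists s : path_through s ->
  exists2 s', path_through s' & induced_path s'.
Proof.
move: {2}(size s) (leqnn (size s)) => n; elim: n s => [|n IH] s sn ps.
  by case: ps => /negP[]; rewrite -size_eq0 -leqn0.
have [ind|/boolp.existsNP[i /boolp.existsNP[j]]] := boolp.EM (induced_path s).
  by exists s.
move=> /boolp.not_implyP[ij /boolp.not_implyP[ij0 /negP/negPn aij]].
apply: IH (shortcut ps ij ij0 aij).
by rewrite size_cat size_takel ?size_drop; lia_size s.
Qed.

(** A repeated vertex gives a chord: the predecessor of its first occurrence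
    is adjacent to its second occurrence. *)
Lemma induced_path_uniq s : a != b -> a \notin K -> b \notin K ->
  path_through s -> induced_path s -> uniq (a :: rcons s b).
Proof.
move=> ab aK bK [_ sK ps] ind.
have as_ : a \notin s by apply: contra aK; exact: sK.
have bs_ : b \notin s by apply: contra bK; exact: sK.
rewrite /= mem_rcons inE negb_or as_ ab rcons_uniq bs_ /=.
apply/(uniqP a) => i j; rewrite !inE; wlog ij : i j / i < j.
  by case: (ltngtP i j) => // ij H ? ? ?; [exact: H|symmetry; exact: H].
move=> _ js e; exfalso.
have := ind i j.+1; rewrite ltnS ij /= ltnS (ltnW js) eqSS (ltn_eqF js) orbT.
move=> /(_ isT isT) /negP; apply.
rewrite /= !nth_rcons js -e.
have : i <= size (rcons s b) by rewrite size_rcons; lia_size s.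
move/(pathP a): ps => /(_ i); rewrite size_rcons nth_rcons.
have -> : i < size s by lia_size s.
by move=> H _; apply: H; lia_size s.
Qed.

Lemma path_through_exists : connected_in K -> touches K a -> touches K b ->
  exists s, path_through s.
Proof.
move=> cK /touchesP[u uK au] /touchesP[v vK bv].
have /connectP[p up vE] := cK u v uK vK.
exists (u :: p); split=> //.
  move=> x; rewrite inE => /predU1P[->//|].
  elim: p u uK {au vE} up => //= y p IH u uK /andP[/and3P[_ yK _] yp].
  by rewrite inE => /predU1P[->//|]; exact: IH yK yp.
rewrite /= au rcons_path -vE adjC bv andbT.
by apply: sub_path up => x y /and3P[].
Qed.

End InducedPath.

(** * Cycles in graphs without theta and K4 minors *)

Section Rings.
Variable G : sgraph.
Hypotheses (noTheta : theta_free G) (noK4 : K4_free G).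
Implicit Types (x y v : G) (s p z : seq G) (D : {set G}).

(** Rings are the cycles of length at least three of the graph. *)
Definition is_ring z := [&& cycle (@adj G) z, uniq z & 2 < size z].

Lemma ring_rot n z : is_ring (rot n z) = is_ring z.
Proof. by rewrite /is_ring rot_cycle rot_uniq size_rot. Qed.

Lemma cycle_span x p y q : cycle (@adj G) (x :: p ++ y :: q) ->
  uniq (x :: p ++ y :: q) -> p != [::] -> spans x y [set v in p].
Proof.
case: p => // u p cyc un _.
have up : path (@adj G) u (rcons p y).
  by move: cyc; rewrite rcons_path /= rcons_cat cat_path /= => /and4P[_ -> -> _].
have xu : adj x u by case/andP: cyc.
move: up; rewrite rcons_path => /andP[up uy].
split.
- exact: connected_in_path.
- by rewrite inE; move: un; rewrite cons_uniq mem_cat => /andP[/norP[]].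
- rewrite inE; move: un; rewrite cons_uniq cat_uniq => /andP[_ /and3P[_]].
  by rewrite /= => /norP[].
- by apply/touchesP; exists u; rewrite // !inE eqxx.
- by apply/touchesP; exists (last u p); [rewrite in_set mem_last|rewrite adjC].
Qed.

Lemma cycle_span' x p y q : cycle (@adj G) (x :: p ++ y :: q) ->
  uniq (x :: p ++ y :: q) -> q != [::] -> spans x y [set v in q].
Proof.
have -> : x :: p ++ y :: q = rot (size (y :: q)) (y :: q ++ x :: p).
  by rewrite -[y :: q ++ _]/((y :: q) ++ _) rot_size_cat.
rewrite rot_cycle rot_uniq => cyc un q0.
by case: (cycle_span cyc un q0).
Qed.

(** If both arcs between x and y had inner vertices, they would form a
    K_{2,3} minor together with D. *)
Lemma spans_disjoint_arcs D x p y q :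
  cycle (@adj G) (x :: p ++ y :: q) -> uniq (x :: p ++ y :: q) ->
  connected_in D -> [disjoint D & x :: p ++ y :: q] ->
  touches D x -> touches D y -> (p == [::]) || (q == [::]).
Proof.
move=> cyc un cD dD tx ty; apply/negPn; rewrite negb_or; apply/negP => /andP[p0 q0].
have notD v : v \in x :: p ++ y :: q -> v \notin D.
  by move=> vz; rewrite (disjointFl dD vz).
have sD : spans x y D by split=> //; apply: notD; rewrite !inE ?mem_cat ?inE eqxx ?orbT.
have dp r : {subset r <= x :: p ++ y :: q} -> [disjoint D & [set v in r]].
  move=> sub; rewrite disjoint_subset; apply/subsetP => v vD.
  by rewrite !inE; apply: contraL vD => /sub/notD.
apply: (noTheta _ sD (cycle_span cyc un p0) (cycle_span' cyc un q0)).
- move: un; rewrite cons_uniq => /andP[+ _]; apply: contraNneq => ->.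
  by rewrite mem_cat inE eqxx orbT.
- by apply: dp => v; rewrite !inE mem_cat => ->; rewrite orbT.
- by apply: dp => v; rewrite !inE mem_cat inE => ->; rewrite !orbT.
- rewrite disjoint_subset; apply/subsetP => v; rewrite !inE => vp.
  move: un; rewrite cons_uniq cat_uniq => /and4P[_ _ /hasPn un _].
  by apply: contraL vp => vq; apply: un; rewrite inE vq orbT.
Qed.

(** A third touched vertex v would have to be a neighbour of both x and y on
    the ring, by [spans_disjoint_arcs]; the ring is then a triangle and D
    completes it to a K_4 minor. *)
Lemma ring_third_untouched D x y r : is_ring [:: x, y & r] -> connected_in D ->
  [disjoint D & [:: x, y & r]] -> touches D x -> touches D y ->
  {in r, forall v, ~~ touches D v}.
Proof.
move=> /and3P[cyc un _] cD dD tx ty v vr; apply/negP => tv.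
case/splitPr: r / vr cyc un dD => r1 r2 cyc un dD.
have q0 : r2 == [::].
  exact: (@spans_disjoint_arcs D x (y :: r1) v r2).
have rotE : rot 1 [:: x, y & r1 ++ v :: r2] = y :: r1 ++ v :: rcons r2 x.
  by rewrite rot1_cons /= rcons_cat.
have cyc' : cycle (@adj G) (y :: r1 ++ v :: rcons r2 x).
  by rewrite -rotE rot_cycle.
have un' : uniq (y :: r1 ++ v :: rcons r2 x) by rewrite -rotE rot_uniq.
have dD' : [disjoint D & y :: r1 ++ v :: rcons r2 x].
  rewrite -rotE (eq_disjoint_r (B := mem [:: x, y & r1 ++ v :: r2]))// => w.
  exact: mem_rot.
have := spans_disjoint_arcs cyc' un' cD dD' ty tv.
clear cyc' un' dD' rotE; case: r2 q0 cyc un dD => // _ cyc un dD.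
rewrite orbF => /eqP r10; subst r1; move: cyc => /= /and4P[xy yv vx _].
have notD w : w \in [:: x; y; v] -> w \notin D.
  by move=> wz; rewrite (disjointFl dD wz).
apply: (noK4 xy yv _ cD) tx ty tv; rewrite ?notD ?inE ?eqxx ?orbT//.
by rewrite adjC.
Qed.

(** The first vertex is repeated at the end, so that the i-th edge joins the
    vertices i and i.+1 for every i up to the length of t. *)
Definition ring_vertex (h : G) (t : seq G) i := nth h (h :: rcons t h) i.

Variables (h : G) (t : seq G).
Hypothesis ht : is_ring (h :: t).
Local Notation w := (ring_vertex h t).

Lemma ring_at i : i <= size t -> exists r, rot i (h :: t) = [:: w i, w i.+1 & r].
Proof.
have t2 : 1 < size t by case/and3P: ht.
move=> it; rewrite /rot (drop_nth h) ?ltnS//.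
have wE j : j <= size t -> w j = nth h (h :: t) j.
  by rewrite /ring_vertex -rcons_cons nth_rcons /= ltnS => ->.
rewrite -wE//; case: (ltnP i (size t)) => [it'|ti].
  rewrite (drop_nth h) ?ltnS// -wE//.
  by exists (drop i.+2 (h :: t) ++ take i (h :: t)).
have ei : i = size t by apply/eqP; rewrite eqn_leq it ti.
rewrite drop_oversize ?ltnS//= ei.
have -> : w (size t).+1 = h by rewrite /ring_vertex /= nth_rcons ltnn eqxx.
by case: t t2 => //= u t' _; exists (take (size t') (u :: t')).
Qed.

(** The rest of the ring, used as a further branch set next to the components
    at its i-th edge. *)
Lemma ring_rest i : i <= size t ->
  exists2 Q, spans (w i) (w i.+1) Q & Q \subset [set v in h :: t].
Proof.
move=> it; have [r rE] := ring_at it.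
have /and3P[cyc un sz] : is_ring [:: w i, w i.+1 & r] by rewrite -rE ring_rot.
exists [set v in r].
  by apply: (@cycle_span' _ [::] _ _ cyc un); case: (r) sz.
apply/subsetP => v; rewrite !inE -in_cons -(mem_rot i) rE !inE => ->.
by rewrite !orbT.
Qed.

(** Outerplanarity along a ring: whatever is attached to it is attached to one
    vertex or to the two ends of one edge. *)
Lemma ring_touch D : connected_in D -> [disjoint D & h :: t] ->
  exists2 i, i <= size t &
    forall v, v \in h :: t -> touches D v -> v = w i \/ v = w i.+1.
Proof.
move=> cD dD.
have dDr i : [disjoint D & rot i (h :: t)].
  by rewrite (eq_disjoint_r (B := mem (h :: t)))// => v; exact: mem_rot.
have adjacent i x y r : rot i (h :: t) = [:: x, y & r] -> touches D x ->
  touches D y -> exists2 i, i <= size t &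
    forall v, v \in h :: t -> touches D v -> v = w i \/ v = w i.+1.
  move=> rE tx ty.
  have [j jt jE] : exists2 j, j <= size t & rot j (h :: t) = rot i (h :: t).
    have [it|ti] := leqP i (size t); first by exists i.
    by exists 0; rewrite // rot0 rot_oversize.
  exists j => // v vz tv; have [r' r'E] := ring_at jt.
  move: r'E; rewrite jE rE => -[<- <- _].
  have := vz; rewrite -(mem_rot i) rE !inE => /or3P[/eqP|/eqP|vr]; [by left|by right|].
  have := ring_third_untouched _ cD _ tx ty vr; rewrite -rE ring_rot => /(_ ht (dDr i)).
  by rewrite tv.
have [/hasP[x xz tx]|/hasPn no] := boolP (has (touches D) (h :: t)); last first.
  by exists 0 => // v /no/negPf->.
have [/hasP[y yz /andP[ty xy]]|/hasPn no] :=
    boolP (has (fun y => touches D y && (x != y)) (h :: t)); last first.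
  have xt : index x (h :: t) <= size t by rewrite -ltnS -[(size t).+1]/(size (h :: t)) index_mem.
  exists (index x (h :: t)) => // v /no; rewrite negb_and => /orP[/negPf->//|].
  move=> /negPn/eqP <- _; left; rewrite /ring_vertex -rcons_cons nth_rcons /= ltnS xt.
  by rewrite -[if _ then _ else _]/(index x (h :: t)) nth_index.
have [i s' sE] := rot_to xz.
have ys : y \in s'.
  by move: yz; rewrite -(mem_rot i) sE inE eq_sym (negPf xy).
case/splitPr: s' / ys sE => p q sE.
have /and3P[cyc un _] : is_ring (x :: p ++ y :: q) by rewrite -sE ring_rot.
have := spans_disjoint_arcs cyc un cD; rewrite -sE => /(_ (dDr i) tx ty).
case/orP => /eqP E; subst; first exact: (adjacent i x y q).
apply: (adjacent (rot_add (h :: t) i (size (x :: p))) y x p) => //.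
by rewrite -rot_rot_add sE -cat_cons rot_size_cat.
Qed.

(** Two components at the same edge and the rest of the ring would form a
    K_{2,3} minor. *)
Lemma ring_touch_unique D1 D2 i : i <= size t ->
  spans (w i) (w i.+1) D1 -> spans (w i) (w i.+1) D2 ->
  [disjoint D1 & h :: t] -> [disjoint D2 & h :: t] -> [disjoint D1 & D2] ->
  False.
Proof.
move=> it s1 s2 d1 d2 d12; have [Q sQ /subsetP Qz] := ring_rest it.
have dQ D : [disjoint D & h :: t] -> [disjoint D & Q].
  move=> dD; rewrite disjoint_subset; apply/subsetP => v vD.
  rewrite inE; apply/negP => /Qz; rewrite inE => vz.
  by rewrite (disjointFl dD vz) in vD.
apply: (noTheta _ s1 s2 sQ d12 (dQ _ d1) (dQ _ d2)).
have [r rE] := ring_at it.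
have /and3P[_ + _] : is_ring [:: w i, w i.+1 & r] by rewrite -rE ring_rot.
by rewrite cons_uniq inE => /andP[/norP[]].
Qed.

End Rings.

(** * Colouring words from lists *)

Section ListColoring.
Variable C : eqType.
Implicit Types (A F : seq C) (y : nat -> C).

Lemma pick_avoiding A F : uniq A -> size F < size A ->
  exists2 x, x \in A & x \notin F.
Proof.
move=> uA FA; have [/allP AF|/allPn] := boolP (all (mem F) A); last by [].
by have := uniq_leq_size uA AF; rewrite leqNgt FA.
Qed.

Lemma pick_two_avoiding A F : uniq A -> (size F).+1 < size A ->
  exists x x', [/\ x \in A, x' \in A, x \notin F, x' \notin F & x != x'].
Proof.
move=> uA FA; have [x xA xF] := pick_avoiding uA (ltnW FA).
have [|x' xA' xF'] := @pick_avoiding A (x :: F) uA; first by [].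
move: xF'; rewrite inE negb_or => /andP[x'x xF'].
by exists x, x'; rewrite eq_sym.
Qed.

(** The first two letters are given; each further letter avoids its two
    predecessors and F. *)
Lemma greedy_word m (A : nat -> seq C) F l1 l0 :
  (forall i, i < m -> uniq (A i) /\ (size F).+2 < size (A i)) ->
  exists y, [/\ y 0 = l1, y 1 = l0 & forall i, i < m ->
    [/\ y i.+2 \in A i, y i.+2 \notin F, y i.+2 != y i.+1 & y i.+2 != y i]].
Proof.
elim: m => [|m IH] H; first by exists (fun k => if k is 0 then l1 else l0).
have [|y [y0 y1 yP]] := IH; first by move=> i im; apply: H; exact: ltnW.
have [uA sA] := H m (leqnn _).
have [c cA] := @pick_avoiding (A m) [:: y m.+1, y m & F] uA sA.
rewrite !inE !negb_or => /and3P[c1 c2 cF].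
exists (fun k => if k == m.+2 then c else y k); split=> // i.
rewrite ltnS leq_eqVlt => /predU1P[->|im]; last first.
  have := yP i im.
  have [-> -> ->] : [/\ (i.+2 == m.+2) = false, (i.+1 == m.+2) = false &
    (i == m.+2) = false] by split; lia.
  by [].
have [-> ->] : (m.+1 == m.+2) = false /\ (m == m.+2) = false by split; lia.
by rewrite eqxx.
Qed.

(** The letters 0, 1 and m.+2, m.+3 are a context: letters at distance one or
    two differ, except within these two pairs. *)
Definition good_word m y : Prop :=
  (forall k, k <= m -> y k.+1 != y k.+2) /\
  (forall k, k <= m.+1 -> y k != y k.+2).

Definition word_over m (A : nat -> seq C) l1 l0 r0 r1 : Prop :=
  exists y, [/\ y 0 = l1, y 1 = l0, y m.+2 = r0 & y m.+3 = r1] /\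
    [/\ good_word m y & forall i, i < m -> y i.+2 \in A i].

(** The outer letters x0 and x3 are chosen so that one of the conditions
    imposed on x1 by l0, x0 and x3 is void.  If no choice does this, the two
    candidates for x0, the two for x3 and l0 are five elements of the list of
    x1. *)
Lemma word_over4 (A : nat -> seq C) l1 l0 r0 r1 :
  (forall i, i < 4 -> uniq (A i) /\ 4 <= size (A i)) ->
  word_over 4 A l1 l0 r0 r1.
Proof.
move=> H.
have [[u0 s0] [u1 s1]] := (H 0 isT, H 1 isT).
have [[u2 s2] [u3 s3]] := (H 2 isT, H 3 isT).
have fin x0 x3 : x0 \in A 0 -> x0 \notin [:: l1; l0] ->
    x3 \in A 3 -> x3 \notin [:: r0; r1] ->
    (forall x2, exists2 x1, x1 \in A 1 & x1 \notin [:: l0; x0; x3; x2]) ->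
    word_over 4 A l1 l0 r0 r1.
  move=> x0A x0l x3A x3r x1E.
  have [//|x2 x2A x2n] := @pick_avoiding (A 2) [:: r0; x0; x3] u2.
  have [x1 x1A x1n] := x1E x2.
  exists (nth r1 [:: l1; l0; x0; x1; x2; x3; r0; r1]); split=> //.
  move: x0l x3r x2n x1n; rewrite !inE !negb_or.
  move=> /andP[n1 n2] /andP[n3 n4] /and3P[n5 n6 n7] /and4P[n8 n9 n10 n11].
  split; last by case=> [|[|[|[|]]]].
  split; case=> [|[|[|[|[|[|?]]]]]] //= _; rewrite // eq_sym//.
have [//|a [a' [aA aA' al al' aa]]] := @pick_two_avoiding (A 0) [:: l1; l0] u0.
have [//|b [b' [bA bA' br br' bb]]] := @pick_two_avoiding (A 3) [:: r0; r1] u3.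
have three x0 x3 z z' : {in A 1, forall x, x \notin [:: z; z'] -> x \notin [:: l0; x0; x3]} ->
    forall x2, exists2 x1, x1 \in A 1 & x1 \notin [:: l0; x0; x3; x2].
  move=> H3 x2; have [//|x1 x1A] := @pick_avoiding (A 1) [:: z; z'; x2] u1.
  rewrite !inE !negb_or => /and3P[z1 z2 z3]; exists x1 => //.
  have := H3 x1 x1A; rewrite !inE !negb_or z1 z2 => /(_ isT)/and3P[-> -> ->].
  by rewrite z3.
have out x0 x3 : (x0 \notin A 1) || (x3 \notin A 1) || (x0 == x3) || (x3 == l0) ->
    forall x2, exists2 x1, x1 \in A 1 & x1 \notin [:: l0; x0; x3; x2].
  have neq x z : x \in A 1 -> z \notin A 1 -> x != z by move=> xA; apply: contraNneq => <-.
  case/orP=> [/orP[/orP[nA|nA]|/eqP e]|/eqP e].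
  - apply: (three _ _ l0 x3) => x xA; rewrite !inE !negb_or => /andP[-> ->].
    by rewrite neq.
  - apply: (three _ _ l0 x0) => x xA; rewrite !inE !negb_or => /andP[-> ->].
    by rewrite neq.
  - by subst; apply: (three _ _ l0 x3) => x xA; rewrite !inE !negb_or => /andP[-> ->].
  - by subst; apply: (three _ _ l0 x0) => x xA; rewrite !inE !negb_or => /andP[-> ->].
have [H1|m1] := boolP ((a \notin A 1) || (b \notin A 1) || (a == b) || (b == l0)).
  by apply: (fin a b) => //; exact: out.
have [H2|m2] := boolP ((a' \notin A 1) || (b' \notin A 1) || (a' == b') || (b' == l0)).
  by apply: (fin a' b') => //; exact: out.
have [H3|m3] := boolP (a == b').
  by apply: (fin a b') => //; apply: out; rewrite H3 !orbT.
have [H4|m4] := boolP (a' == b).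
  by apply: (fin a' b) => //; apply: out; rewrite H4 !orbT.
apply: (fin a b) => //.
move: m1 m2; rewrite !negb_or !negbK.
move=> /andP[/andP[/andP[aA1 bA1] ab] bl] /andP[/andP[/andP[aA1' bA1'] ab'] bl'].
have [lA|lA] := boolP (l0 \in A 1); last first.
  apply: (three _ _ a b) => x xA; rewrite !inE !negb_or => /andP[-> ->].
  by rewrite !andbT; apply: contraNneq lA => <-.
(* No condition on x1 is void, but its list is long enough. *)
have five : 5 <= size (A 1).
  apply: (@uniq_leq_size _ [:: l0; a; a'; b; b']) => [|x].
    move: al al'; rewrite !inE !negb_or => /andP[_ al] /andP[_ al'].
    by rewrite /= !inE !negb_or aa bb ab ab' m3 m4 !(eq_sym l0) al al' bl bl'.
  by rewrite !inE => /or4P[/eqP->|/eqP->|/eqP->|/orP[/eqP->|/eqP->]].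
by move=> x2; exact: pick_avoiding.
Qed.

Lemma word_over_cons m (A : nat -> seq C) x l1 l0 r0 r1 : 1 < m ->
  x \in A 0 -> x != l0 -> x != l1 ->
  word_over m (fun i => A i.+1) l0 x r0 r1 -> word_over m.+1 A l1 l0 r0 r1.
Proof.
move=> m1 xA xl0 xl1 [y [[y0 y1 yr0 yr1] [[y12 y02] yA]]].
exists (fun k => if k is k'.+1 then y k' else l1); split=> //.
split; last by case=> [|i] im; [rewrite y1|apply: yA].
split=> -[|k] km.
- by rewrite y0 y1 eq_sym.
- exact: y12.
- by rewrite y1 eq_sym.
- exact: y02.
Qed.

Lemma word_over_long m (A : nat -> seq C) l1 l0 r0 r1 : 4 <= m ->
  (forall i, i < m -> uniq (A i) /\ 4 <= size (A i)) ->
  word_over m A l1 l0 r0 r1.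
Proof.
elim: m A l1 l0 => [//|m IH] A l1 l0; rewrite leq_eqVlt => /predU1P[<-|m4] H.
  exact: word_over4.
have [u0 s0] := H 0 isT.
have [|x xA] := @pick_avoiding (A 0) [:: l0; l1] u0; first exact: leq_trans s0.
rewrite !inE negb_or => /andP[x0 x1].
apply: (@word_over_cons _ _ x) => //; first lia.
by apply: IH => // i im; apply: H.
Qed.

Lemma word_over2 (A : nat -> seq C) l1 l0 r0 r1 :
  (forall i, i < 2 -> uniq (A i) /\ 4 <= size (A i)) ->
  r0 \in [:: l0; l1] -> r1 \in [:: l0; l1] -> word_over 2 A l1 l0 r0 r1.
Proof.
move=> H r0l r1l; have [[u0 s0] [u1 s1]] := (H 0 isT, H 1 isT).
have [|x0 x0A] := @pick_avoiding (A 0) [:: l0; l1] u0; first exact: leq_trans s0.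
have [//|x1 x1A] := @pick_avoiding (A 1) [:: x0; l0; l1] u1.
rewrite !inE !negb_or => /and3P[n1 n2 n3] /andP[n4 n5].
exists (nth r1 [:: l1; l0; x0; x1; r0; r1]); split=> //.
split; last by case=> [|[|]].
have avoid x r : x != l0 -> x != l1 -> r \in [:: l0; l1] -> x != r.
  by move=> xl0 xl1; rewrite !inE => /orP[/eqP->|/eqP->].
split; case=> [|[|[|[|?]]]] //= _; rewrite // 1?eq_sym//.
all: rewrite ?[_ == x0]eq_sym ?[_ == x1]eq_sym.
all: by first [exact: avoid | rewrite eq_sym; exact: avoid].
Qed.

(** Colours of a ring through an old vertex of colour x with witness c: the
    word is read along the ring from this vertex back to it. *)
Lemma word_around m (A : nat -> seq C) c x : 2 <= m ->
  (forall i, i < m -> uniq (A i) /\ 4 <= size (A i)) ->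
  word_over m A c x x c.
Proof.
case: m => [|[|[|[|m]]]] // _ H; last exact: word_over_long.
  by apply: word_over2 => //; rewrite !inE eqxx ?orbT.
have [[u0 s0] [[u1 s1] [u2 s2]]] := (H 0 isT, (H 1 isT, H 2 isT)).
have [|x0 x0A] := @pick_avoiding (A 0) [:: x; c] u0; first exact: leq_trans s0.
have [//|x2 x2A] := @pick_avoiding (A 2) [:: x0; x; c] u2.
have [//|x1 x1A] := @pick_avoiding (A 1) [:: x0; x2; x] u1.
rewrite !inE !negb_or => /and3P[n1 n2 n3] /and3P[n4 n5 n6] /andP[n7 n8].
exists (nth c [:: c; x; x0; x1; x2; x; c]); split=> //.
split; last by case=> [|[|[|]]].
by split; case=> [|[|[|[|[|?]]]]] //= _; rewrite // eq_sym.
Qed.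

(** Colours of a ring with two consecutive vertices already coloured a and b.
    For m = 3 the square of the ring is K_5, and lists of size four do not
    suffice. *)
Lemma word_cycle m (A : nat -> seq C) a b : 0 < m -> m != 3 -> a != b ->
  (forall i, i < m -> uniq (A i) /\ 4 <= size (A i)) ->
  word_over m A b a b a.
Proof.
case: m => [|[|[|[|m]]]] // _ _ ab H; last exact: word_over_long.
  have [u0 s0] := H 0 isT.
  have [|x0 x0A] := @pick_avoiding (A 0) [:: a; b] u0; first exact: leq_trans s0.
  rewrite !inE !negb_or => /andP[n1 n2].
  exists (nth a [:: b; a; x0; b; a]); split=> //.
  split; last by case=> [|[|[|]]].
  by split; case=> [|[|[|[|[|?]]]]] //= _; rewrite // eq_sym.
by apply: word_over2; rewrite // !inE eqxx ?orbT.
Qed.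

End ListColoring.

(** * Extending partial colourings *)

Section Extensions.
Variables (G : sgraph) (C : eqType) (L : G -> seq C).
Implicit Types (K U X D : {set G}) (phi psi c : G -> C).

Definition conflict_free_at psi v : Prop :=
  exists2 u, adj v u & forall w, adj v w -> psi w = psi u -> w = u.

(** In the last condition c w is the witness of the old vertex w: it must
    remain unique in the neighbourhood of w. *)
Definition extends K phi c psi : Prop :=
  [/\ forall v, v \notin K -> psi v = phi v,
      forall v, v \in K -> psi v \in L v,
      forall v w, v \in K -> adj v w -> psi v != psi w,
      forall v, v \in K -> conflict_free_at psi v &
      forall v w, v \in K -> w \notin K -> adj v w -> psi v != c w].

Definition extendable K phi c : Prop := exists psi, extends K phi c psi.

Lemma conflict_free_at_eq psi psi' v :
  (forall w, adj v w -> psi' w = psi w) ->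
  conflict_free_at psi v -> conflict_free_at psi' v.
Proof.
move=> E [u vu uniq_u]; exists u => // w vw.
by rewrite !E//; exact: uniq_u.
Qed.

Lemma extendable_local D phi c phi' c' :
  (forall v w, v \in D -> w \notin D -> adj v w ->
     phi' w = phi w /\ c' w = c w) ->
  extendable D phi c -> extendable D phi' c'.
Proof.
move=> loc [psi [p_out p_L p_prop p_cf p_c]].
pose psi' v := if v \in D then psi v else phi' v.
have E v w : v \in D -> adj v w -> psi' w = psi w.
  move=> vD vw; rewrite /psi'; case: ifPn => // wD.
  by rewrite p_out//; case: (loc v w vD wD vw).
have E' v : v \in D -> psi' v = psi v by move=> vD; rewrite /psi' vD.
exists psi'; split.
- by move=> v vD; rewrite /psi' (negPf vD).
- by move=> v vD; rewrite E'//; exact: p_L.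
- by move=> v w vD vw; rewrite E'// (E v)//; exact: p_prop.
- by move=> v vD; apply: conflict_free_at_eq (p_cf v vD) => w; exact: E.
- move=> v w vD wD vw; rewrite E'//; have [_ ->] := loc v w vD wD vw.
  exact: p_c.
Qed.

Definition boundary_in K (P : pred G) : Prop :=
  forall v w, v \in K -> w \notin K -> adj v w -> P w.

Lemma component_boundary U v x w : x \in component U v ->
  w \notin component U v -> adj x w -> w \notin U.
Proof.
by move=> xD wD xw; apply: contra wD => wU; exact: component_closed xD wU xw.
Qed.

(** Otherwise the component would be all of K. *)
Lemma component_touch K X v : connected_in K -> X \subset K -> X != set0 ->
  v \in K :\: X -> exists2 x, x \in X & touches (component (K :\: X) v) x.
Proof.
move=> cK /subsetP XK /set0Pn[x xX] vU.
have [/existsP[y /andP[yX ty]]|no] :=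
  boolP [exists y, (y \in X) && touches (component (K :\: X) v) y].
  by exists y.
have : K \subset component (K :\: X) v.
  apply: connected_in_trapped => //.
    move=> u w /setIP[uK uD] wK uw; apply: contraNT no => wD.
    have := component_boundary uD wD uw; rewrite inE wK andbT negbK => wX.
    apply/existsP; exists w; rewrite wX; apply/touchesP; exists u => //.
    by rewrite adjC.
  apply/set0Pn; exists v; rewrite inE component_self// andbT.
  by have /setDP[] := vU.
move=> /subsetP/(_ x (XK x xX))/(subsetP (component_sub _ _)).
by rewrite inE xX.
Qed.

(** Components of the rest of K do not see each other, so that extensions to
    them can be chosen independently.  A vertex of X keeps its witness because
    its neighbours in the components avoid c'. *)
Lemma extendable_glue K X phi c phi' c' :
  X \subset K ->
  (forall v, v \notin X -> phi' v = phi v) ->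
  (forall v, v \notin X -> c' v = c v) ->
  (forall v, v \in X -> phi' v \in L v) ->
  (forall v w, v \in X -> adj v w -> w \notin K :\: X -> phi' v != phi' w) ->
  (forall v w, v \in X -> adj v w -> w \notin K -> phi' v != c w) ->
  (forall v, v \in X -> exists u, [/\ adj v u, u \notin K :\: X, phi' u = c' v
     & forall w, adj v w -> w \notin K :\: X -> phi' w = c' v -> w = u]) ->
  (forall v, v \in K :\: X -> extendable (component (K :\: X) v) phi' c') ->
  extendable K phi c.
Proof.
move=> /subsetP XK phi_out c_out X_L X_prop X_c X_cf comp_ext.
set U := K :\: X in X_prop X_cf comp_ext *.
have /boolp.choice[f fP] : forall D : {set G}, exists psi,
    forall v, v \in U -> D = component U v -> extends D phi' c' psi.
  move=> D; have [[v vU ->]|nD] := boolp.EM (exists2 v, v \in U & D = component U v).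
    by have [psi psiP] := comp_ext v vU; exists psi.
  by exists phi' => v vU DE; case: nD; exists v.
pose psi v := if v \in U then f (component U v) v else phi' v.
have UP v (vU : v \in U) := fP _ v vU erefl.
have psi_comp v w : v \in U -> w \in component U v ->
    psi w = f (component U v) w.
  move=> vU wD; have wU := subsetP (component_sub _ _) _ wD.
  by rewrite /psi wU (component_eq wD).
have psi_near v w : v \in U -> adj v w -> psi w = f (component U v) w.
  move=> vU vw; have [wD|wD] := boolP (w \in component U v); first exact: psi_comp.
  have [p_out _ _ _ _] := UP v vU; rewrite p_out// /psi.
  by rewrite (negPf (component_boundary (component_self vU) wD vw)).
have psi_self v : v \in U -> psi v = f (component U v) v.
  by move=> vU; apply: psi_comp => //; exact: component_self.
have psi_out v : v \notin U -> psi v = phi' v by rewrite /psi => /negPf->.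
have KX v : v \in K -> v \notin U -> v \in X by move=> vK; rewrite inE vK andbT negbK.
have XU v : v \in X -> v \notin U by move=> vX; rewrite inE vX.
have U_c v w : v \in U -> w \notin U -> adj v w -> psi v != c' w.
  move=> vU wU vw; have [_ _ _ _ p_c] := UP v vU; rewrite psi_self//.
  apply: p_c => //; first exact: component_self.
  by apply: contra wU; apply/subsetP/component_sub.
have U_prop v w : v \in U -> adj v w -> psi v != psi w.
  move=> vU vw; have [_ _ p_prop _ _] := UP v vU.
  by rewrite psi_self// (psi_near v)//; apply: p_prop => //; exact: component_self.
exists psi; split.
- move=> v vK; have vX : v \notin X by apply: contra vK; exact: XK.
  by rewrite psi_out ?phi_out// inE negb_and vK orbT.
- move=> v vK; have [vU|vU] := boolP (v \in U).
    by have [_ p_L _ _ _] := UP v vU; rewrite psi_self//; apply/p_L/component_self.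
  by rewrite psi_out//; apply/X_L/KX.
- move=> v w vK vw; have [vU|vU] := boolP (v \in U); first exact: U_prop.
  have [wU|wU] := boolP (w \in U); first by rewrite eq_sym U_prop// adjC.
  by rewrite !psi_out//; apply: X_prop => //; exact: KX.
- move=> v vK; have [vU|vU] := boolP (v \in U).
    have [_ _ _ p_cf _] := UP v vU.
    apply: conflict_free_at_eq (p_cf v (component_self vU)) => w.
    exact: psi_near.
  have [u [vu uU uc u_uniq]] := X_cf v (KX v vK vU).
  exists u => // w vw; rewrite (psi_out u uU) uc.
  have [wU|wU] := boolP (w \in U); last by rewrite psi_out//; exact: u_uniq.
  by move=> e; have := U_c w v wU vU; rewrite adjC e eqxx => /(_ vw).
- move=> v w vK wK vw; have wX : w \notin X by apply: contra wK; exact: XK.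
  have wU : w \notin U by rewrite inE negb_and wK orbT.
  have [vU|vU] := boolP (v \in U); first by rewrite -c_out//; exact: U_c.
  by rewrite psi_out//; apply: X_c => //; exact: KX.
Qed.

Definition hanging_extendable K : Prop := forall x phi c,
  connected_in K -> x \notin K -> touches K x -> boundary_in K (pred1 x) ->
  phi x != c x -> extendable K phi c.

Definition recolor c (b : G) (d : C) : G -> C := fun v => if v == b then d else c v.

(** At most one witness of b is bad for K.  The set Q is a connection of a and
    b on the other side of the edge ab; it prevents a component of K from being
    wedged at ab again. *)
Definition wedged_extendable K : Prop := forall a b phi c d,
  adj a b -> spans a b K -> boundary_in K (pred2 a b) ->
  (exists2 Q, spans a b Q & [disjoint Q & K]) ->
  phi a != phi b -> phi a != c a -> phi b != c b -> phi b != d -> c b != d ->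
  extendable K phi c \/ extendable K phi (recolor c b d).

End Extensions.

(** * Pieces along a cycle *)

Section Choices.
Variables (C : Type) (OK : nat -> C -> C -> Prop) (valid : nat -> C -> Prop).
Variables (o1 o2 : nat -> C).

Definition is_option i c := c = o1 i \/ c = o2 i.

(** Each value is chosen among two options, so that the condition between it
    and the previous value holds. *)
Lemma forward_choice N c0 : valid 0 c0 ->
  (forall i c, 0 < i <= N -> is_option i c -> valid i c) ->
  (forall i c, i < N -> valid i c ->
     OK i c (o1 i.+1) \/ OK i c (o2 i.+1)) ->
  exists e, e 0 = c0 /\
    forall i, i < N -> OK i (e i) (e i.+1) /\ is_option i.+1 (e i.+1).
Proof.
move=> v0; elim: N => [|N IH] Hv H; first by exists (fun=> c0).
have [||e [e0 eP]] := IH.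
- by move=> i c /andP[i0 iN]; apply: Hv; rewrite i0 ltnW.
- by move=> i c iN; apply: H; exact: ltnW.
have vN : valid N (e N).
  case: N eP {IH H} Hv => [|N] eP Hv; first by rewrite e0.
  by apply: Hv; rewrite ?leqnSn//; have [] := eP N (leqnn _).
have [d [dO dOK]] : exists d, is_option N.+1 d /\ OK N (e N) d.
  by case: (H N (e N) (leqnn _) vN) => ok;
    [exists (o1 N.+1)|exists (o2 N.+1)]; split=> //; [left|right].
exists (fun k => if k == N.+1 then d else e k); split=> // i.
rewrite ltnS leq_eqVlt => /predU1P[->|iN].
  by rewrite eqxx (_ : N == N.+1 = false)//; lia.
have [-> ->] : (i == N.+1) = false /\ (i.+1 == N.+1) = false by split; lia.
exact: eP.
Qed.

End Choices.

Lemma backward_choice C (OK : nat -> C -> C -> Prop) (valid : nat -> C -> Prop)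
    (o1 o2 : nat -> C) N cN : valid N cN ->
  (forall i c, i < N -> is_option o1 o2 i c -> valid i c) ->
  (forall i c, i < N -> valid i.+1 c -> OK i (o1 i) c \/ OK i (o2 i) c) ->
  exists e, e N = cN /\
    forall i, i < N -> OK i (e i) (e i.+1) /\ is_option o1 o2 i (e i).
Proof.
move=> vN Hv H.
have [|||e [e0 eP]] := @forward_choice C (fun i c d => OK (N - i.+1) d c)
    (fun i => valid (N - i)) (fun i => o1 (N - i)) (fun i => o2 (N - i)) N cN.
- by rewrite subn0.
- by move=> i c iN oc; apply: Hv oc; lia.
- move=> i c iN; have -> : N - i = (N - i.+1).+1 by lia.
  by apply: H; lia.
exists (fun k => e (N - k)); split=> [|i iN]; first by rewrite subnn.
have := eP (N - i.+1); rewrite /is_option /=; have -> : (N - i.+1).+1 = N - i by lia.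
have -> : N - (N - i) = i by lia.
by apply; lia.
Qed.

(** With both end values prescribed, choose forwards up to the void condition j
    and backwards down to it. *)
Lemma pinned_choice C (OK : nat -> C -> C -> Prop) (valid : nat -> C -> Prop)
    (o1 o2 : nat -> C) N j c0 cN : j < N ->
  (forall c d, OK j c d) -> valid 0 c0 -> valid N cN ->
  (forall i c, 0 < i < N -> is_option o1 o2 i c -> valid i c) ->
  (forall i c, i.+1 < N -> valid i c ->
     OK i c (o1 i.+1) \/ OK i c (o2 i.+1)) ->
  (forall i c, 0 < i < N -> valid i.+1 c ->
     OK i (o1 i) c \/ OK i (o2 i) c) ->
  exists e, [/\ e 0 = c0, e N = cN,
    forall i, i < N -> OK i (e i) (e i.+1) &
    forall i, 0 < i < N -> is_option o1 o2 i (e i)].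
Proof.
move=> jN OKj v0 vN Hv Hf Hb.
have [||f [f0 fP]] := @forward_choice C OK valid o1 o2 j c0 v0.
- by move=> i c ij; apply: Hv; lia.
- by move=> i c ij; apply: Hf; lia.
pose sh i := i + j.+1.
have [|||g [gN gP]] := @backward_choice C (fun i => OK (sh i))
    (fun i => valid (sh i)) (fun i => o1 (sh i)) (fun i => o2 (sh i))
    (N - j.+1) cN.
- by rewrite /sh subnK.
- by move=> i c iN; apply: Hv; rewrite /sh; lia.
- move=> i c iN; have ran : 0 < sh i < N by rewrite /sh; lia.
  exact: Hb ran.
exists (fun k => if k <= j then f k else g (k - j.+1)); split=> //.
- by rewrite leqNgt jN.
- move=> i iN; case: (ltngtP i j) => [ij|ji|->].
  + by have [] := fP i ij.
  + have [|+ _] := gP (i - j.+1); first by lia.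
    by rewrite /sh subnK// -subSn.
  + exact: OKj.
- move=> [//|i] /= iN; case: (ltnP i j) => [ij|ji]; first by have [] := fP i ij.
  have [|_] := gP (i.+1 - j.+1); first by lia.
  by rewrite /is_option /sh subnK.
Qed.

Section RingColoring.
Variables (G : sgraph) (C : eqType) (L : G -> seq C).
Hypotheses (noTheta : theta_free G) (noK4 : K4_free G).
Variables (h : G) (t : seq G).
Hypothesis ht : is_ring (h :: t).
Local Notation z := (h :: t).
Local Notation n := (size t).
Local Notation w := (ring_vertex h t).

Lemma ring_last : w n.+1 = w 0.
Proof. by rewrite /ring_vertex /= nth_rcons ltnn eqxx. Qed.

Lemma ring_nth i : i <= n -> w i = nth h z i.
Proof. by rewrite /ring_vertex -rcons_cons nth_rcons /= ltnS => ->. Qed.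

Lemma ring_index i : i <= n -> index (w i) z = i.
Proof. by have /and3P[_ un _] := ht; move=> iN; rewrite ring_nth// index_uniq. Qed.

Lemma ring_mem i : i <= n.+1 -> w i \in z.
Proof.
rewrite leq_eqVlt => /predU1P[->|iN]; first by rewrite ring_last mem_head.
by rewrite ring_nth// mem_nth.
Qed.

Lemma ring_memE v : v \in z -> exists2 i, i <= n & v = w i.
Proof.
move=> vz; have vi : index v z <= n by rewrite -ltnS -[n.+1]/(size z) index_mem.
by exists (index v z); rewrite // ring_nth// nth_index.
Qed.

Lemma ring_adj i : i <= n -> adj (w i) (w i.+1).
Proof.
move=> iN; have [r rE] := ring_at ht iN.
have /and3P[+ _ _] : is_ring [:: w i, w i.+1 & r] by rewrite -rE ring_rot.
by case/andP.
Qed.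

Variable U : {set G}.
Hypothesis U_ring : [disjoint U & z].
Hypothesis U_boundary : boundary_in U (mem z).
Hypothesis U_touch : forall v, v \in U ->
  exists2 x, x \in z & touches (component U v) x.
Hypothesis U_hanging : forall v, v \in U -> hanging_extendable L (component U v).
Hypothesis U_wedged : forall v, v \in U -> wedged_extendable L (component U v).

Lemma component_ring v : [disjoint component U v & z].
Proof. exact: disjointWl (component_sub U v) U_ring. Qed.

Lemma ring_notin v x : x \in z -> x \notin component U v.
Proof. by move=> xz; rewrite (disjointFl (component_ring v) xz). Qed.

Lemma component_wedge v : v \in U -> exists2 i, i <= n &
  boundary_in (component U v) (pred2 (w i) (w i.+1)).
Proof.
move=> vU.
have [i iN iP] := ring_touch noTheta noK4 ht (@connected_in_component _ U v)
  (component_ring v).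
exists i => // x y xD yD xy.
have yz : y \in z.
  apply: U_boundary (component_boundary xD yD xy) xy.
  exact: subsetP (component_sub _ _) _ xD.
have [||->|->] := iP y; rewrite //= ?eqxx ?orbT//.
by apply/touchesP; exists x; rewrite // adjC.
Qed.

(** The edge found by [component_wedge] must be this one, as its ends include
    both ends of the edge i. *)
Lemma component_wedge_at v i : v \in U -> i <= n ->
  touches (component U v) (w i) -> touches (component U v) (w i.+1) ->
  boundary_in (component U v) (pred2 (w i) (w i.+1)).
Proof.
move=> vU iN /touchesP[x xD wx] /touchesP[y yD wy].
have [j jN jP] := component_wedge vU.
have := jP x (w i) xD (ring_notin _ (ring_mem (leqW iN))).
have := jP y (w i.+1) yD (ring_notin _ (ring_mem (iN : i.+1 <= n.+1))).
rewrite !(adjC _ (w _)) wx wy => /(_ isT)/= e2 /(_ isT)/= e1 u q uD qD uq.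
have := jP u q uD qD uq; have := adj_neq (ring_adj iN); move: e1 e2 => /=.
by case/orP=> /eqP->; case/orP=> /eqP->; rewrite ?eqxx // orbC.
Qed.

Lemma component_spans v i : v \in U -> i <= n ->
  touches (component U v) (w i) -> touches (component U v) (w i.+1) ->
  spans (w i) (w i.+1) (component U v).
Proof.
move=> vU iN t1 t2; split=> //; first exact: connected_in_component.
  exact: ring_notin (ring_mem (leqW iN)).
exact: ring_notin (ring_mem (iN : i.+1 <= n.+1)).
Qed.

Lemma component_unique v v' i : v \in U -> v' \in U -> i <= n ->
  touches (component U v) (w i) -> touches (component U v) (w i.+1) ->
  touches (component U v') (w i) -> touches (component U v') (w i.+1) ->
  component U v' = component U v.
Proof.
move=> vU v'U iN t1 t2 t1' t2'.
have [|/pred0Pn[x /andP[/= xD xD']]] :=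
    boolP [disjoint component U v & component U v'].
  move=> dd; exfalso.
  apply: (@ring_touch_unique _ noTheta _ _ ht _ _ i iN _ _
    (component_ring v) (component_ring v') dd); exact: component_spans.
by rewrite -(component_eq xD) (component_eq xD').
Qed.

Variable phi : G -> C.
Hypothesis phi_ring : forall i, i <= n -> phi (w i) != phi (w i.+1).

(** Only the witnesses at the two ends of an edge matter for a component
    wedged there. *)
Definition at_first (a : G) (c1 c2 : C) : G -> C :=
  fun x => if x == a then c1 else c2.

Definition wedge_ok i c1 c2 : Prop := forall v, v \in U ->
  touches (component U v) (w i) -> touches (component U v) (w i.+1) ->
  extendable L (component U v) phi (at_first (w i) c1 c2).

Lemma wedge_ok_witness i : i <= n -> (forall c1 c2, wedge_ok i c1 c2) \/
  exists v, [/\ v \in U, touches (component U v) (w i),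
    touches (component U v) (w i.+1) & forall c1 c2,
      extendable L (component U v) phi (at_first (w i) c1 c2) ->
      wedge_ok i c1 c2].
Proof.
move=> iN; have [[v [vU t1 t2]]|no] := boolp.EM (exists v, [/\ v \in U,
    touches (component U v) (w i) & touches (component U v) (w i.+1)]).
  right; exists v; split=> // c1 c2 ext v' v'U t1' t2'.
  by rewrite (component_unique vU v'U iN t1 t2 t1' t2').
by left=> c1 c2 v vU t1 t2; case: no; exists v.
Qed.

(** The connection required by [wedged_extendable] is the rest of the ring. *)
Lemma third_side v i : v \in U -> i <= n ->
  exists2 Q, spans (w i) (w i.+1) Q & [disjoint Q & component U v].
Proof.
move=> vU iN; have [Q sQ Qz] := ring_rest ht iN; exists Q => //.
rewrite disjoint_sym disjoint_subset; apply/subsetP => x xD; rewrite inE.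
apply/negP => /(subsetP Qz); rewrite inE => xz.
by rewrite (negPf (ring_notin v xz)) in xD.
Qed.

(** One of the two options for the far witness is good, as at most one
    component is wedged at the edge. *)
Lemma wedge_ok_right i c1 d d' : i <= n -> phi (w i) != c1 ->
  phi (w i.+1) != d -> phi (w i.+1) != d' -> d != d' ->
  wedge_ok i c1 d \/ wedge_ok i c1 d'.
Proof.
move=> iN n1 nd nd' dd; have [ok|[v [vU t1 t2 ok]]] := wedge_ok_witness iN.
  by left.
have ij : w i.+1 != w i by rewrite eq_sym; exact: adj_neq (ring_adj iN).
have := U_wedged vU (ring_adj iN) (component_spans vU iN t1 t2)
  (component_wedge_at vU iN t1 t2) (third_side vU iN) (phi_ring iN).
move=> /(_ (at_first (w i) c1 d) d').
rewrite /at_first eqxx (negPf ij) => /(_ n1 nd nd' dd)[ext|ext].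
  by left; apply: ok.
right; apply: ok; apply: extendable_local ext => x y xD yD xy; split=> //.
have /orP[/eqP->|/eqP->] := component_wedge_at vU iN t1 t2 xD yD xy.
  by rewrite /recolor /at_first eqxx eq_sym (negPf ij).
by rewrite /recolor /at_first eqxx (negPf ij).
Qed.

Lemma spans_sym (a b : G) Q : spans a b Q -> spans b a Q.
Proof. by case. Qed.

Lemma wedge_ok_left i c2 d d' : i <= n -> phi (w i.+1) != c2 ->
  phi (w i) != d -> phi (w i) != d' -> d != d' ->
  wedge_ok i d c2 \/ wedge_ok i d' c2.
Proof.
move=> iN n2 nd nd' dd; have [ok|[v [vU t1 t2 ok]]] := wedge_ok_witness iN.
  by left.
have ij : w i.+1 != w i by rewrite eq_sym; exact: adj_neq (ring_adj iN).
have bd : boundary_in (component U v) (pred2 (w i.+1) (w i)).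
  move=> x y xD yD xy; have := component_wedge_at vU iN t1 t2 xD yD xy.
  by rewrite /= orbC.
have [Q sQ dQ] := third_side vU iN.
have phi' : phi (w i.+1) != phi (w i) by rewrite eq_sym phi_ring.
have adj' : adj (w i.+1) (w i) by rewrite adjC ring_adj.
have := U_wedged vU adj' (spans_sym (component_spans vU iN t1 t2)) bd
  (ex_intro2 _ _ Q (spans_sym sQ) dQ) phi'.
move=> /(_ (at_first (w i) d c2) d').
rewrite /at_first eqxx (negPf ij) => /(_ n2 nd nd' dd)[ext|ext].
  by left; apply: ok.
right; apply: ok; apply: extendable_local ext => x y xD yD xy; split=> //.
have /orP[/eqP->|/eqP->] := bd _ _ xD yD xy.
  by rewrite /recolor /at_first (negPf ij).
by rewrite /recolor /at_first eqxx.
Qed.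

Lemma ring_components_extendable c :
  (forall i, i <= n -> phi (w i) != c (w i)) ->
  (forall i, i <= n -> wedge_ok i (c (w i)) (c (w i.+1))) ->
  forall v, v \in U -> extendable L (component U v) phi c.
Proof.
move=> cN ok v vU; have [i iN iP] := component_wedge vU.
have ij : w i.+1 != w i by rewrite eq_sym; exact: adj_neq (ring_adj iN).
have cN' : phi (w i.+1) != c (w i.+1).
  move: iN; rewrite leq_eqVlt => /predU1P[->|]; last exact: cN.
  by rewrite ring_last; exact: cN.
have conn := @connected_in_component _ U v.
have iz := ring_mem (leqW iN); have jz : w i.+1 \in z by exact: ring_mem.
have hang x : x \in z -> phi x != c x -> touches (component U v) x ->
    boundary_in (component U v) (pred1 x) -> extendable L (component U v) phi c.
  move=> xz xc tx bx; exact: (U_hanging vU conn (ring_notin v xz) tx bx xc).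
have single x y : boundary_in (component U v) (pred2 x y) ->
    ~~ touches (component U v) x -> boundary_in (component U v) (pred1 y).
  move=> bd nx u q uD qD uq; have /orP[/eqP qx|//] := bd u q uD qD uq.
  by case/touchesP: nx; exists u; rewrite // adjC -qx.
have iP' : boundary_in (component U v) (pred2 (w i.+1) (w i)).
  by move=> u q uD qD uq; have := iP u q uD qD uq; rewrite /= orbC.
have [t1|t1] := boolP (touches (component U v) (w i)); last first.
  have [t2|t2] := boolP (touches (component U v) (w i.+1)).
    by apply: (hang (w i.+1)) => //; exact: single iP t1.
  have [x xz /touchesP[u uD xu]] := U_touch vU.
  have := single _ _ iP t1 u x uD (ring_notin v xz).
  rewrite adjC xu => /(_ isT)/eqP xE; case/touchesP: t2; exists u => //.
  by rewrite -xE.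
have [t2|t2] := boolP (touches (component U v) (w i.+1)); last first.
  by apply: (hang (w i)) => //; [exact: cN|exact: single iP' t2].
apply: extendable_local (ok i iN v vU t1 t2) => x y xD yD xy; split=> //.
have /orP[/eqP->|/eqP->] := iP x y xD yD xy.
  by rewrite /at_first eqxx.
by rewrite /at_first (negPf ij).
Qed.

End RingColoring.

Section RingExtension.
Variables (G : sgraph) (C : eqType) (L : G -> seq C).
Hypotheses (noTheta : theta_free G) (noK4 : K4_free G).
Variables (h : G) (t : seq G).
Hypothesis ht : is_ring (h :: t).
Local Notation n := (size t).

Local Notation w := (ring_vertex h t).

Definition ring_pred i := if i is i'.+1 then i' else n.

(** Colours on the ring are given by position and elsewhere by phi; the same
    operation is used for witnesses. *)
Definition ring_paint (Phi : nat -> C) (phi : G -> C) : G -> C :=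
  fun v => if v \in h :: t then Phi (index v (h :: t)) else phi v.

Lemma ring_paintE Phi phi i : Phi n.+1 = Phi 0 -> i <= n.+1 ->
  ring_paint Phi phi (w i) = Phi i.
Proof.
move=> Phin iN; rewrite /ring_paint (ring_mem h iN).
move: iN; rewrite leq_eqVlt => /predU1P[->|iN].
  by rewrite ring_last ring_index.
by rewrite (ring_index ht iN).
Qed.

(** The common end of all three colouring steps.  X consists of the ring
    vertices to be coloured, Phi and e give the colours and the witnesses along
    the ring; what remains is to serve the components at its edges. *)
Lemma ring_extend (K X : {set G}) (phi c : G -> C) (Phi e : nat -> C) :
  X \subset K ->
  (forall v, v \in h :: t -> v \in K -> v \in X) ->
  {subset X <= h :: t} ->
  boundary_in (K :\: X) (mem (h :: t)) ->
  (forall v, v \in K :\: X ->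
     exists2 x, x \in h :: t & touches (component (K :\: X) v) x) ->
  (forall v, v \in K :\: X -> hanging_extendable L (component (K :\: X) v)) ->
  (forall v, v \in K :\: X -> wedged_extendable L (component (K :\: X) v)) ->
  Phi n.+1 = Phi 0 -> e n.+1 = e 0 ->
  (forall i, i <= n -> w i \notin X -> Phi i = phi (w i) /\ e i = c (w i)) ->
  (forall i, i <= n -> Phi i != Phi i.+1) ->
  (forall i, i <= n -> Phi i != e i) ->
  (forall i u, i <= n -> w i \in X -> adj (w i) u -> u \notin K :\: X ->
     u = w (ring_pred i) \/ u = w i.+1) ->
  (forall i, i <= n -> w i \in X -> Phi i \in L (w i)) ->
  (forall i, i <= n -> w i \in X -> Phi (ring_pred i) != Phi i.+1) ->
  (forall i, i <= n -> w i \in X ->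
     e i = Phi (ring_pred i) \/ e i = Phi i.+1) ->
  (forall i, i <= n -> w i \in X -> w (ring_pred i) \notin X ->
     Phi i != e (ring_pred i)) ->
  (forall i, i <= n -> w i \in X -> w i.+1 \notin X -> Phi i != e i.+1) ->
  (forall i, i <= n ->
     wedge_ok L h t (K :\: X) (ring_paint Phi phi) i (e i) (e i.+1)) ->
  extendable L K phi c.
Proof.
move=> XK zX Xz bU tU hU wU Pn en old edge valid nbr inL cf eP av1 av2 ok.
have paint i : i <= n.+1 -> ring_paint Phi phi (w i) = Phi i.
  exact: ring_paintE.
have cpaint i : i <= n.+1 -> ring_paint e c (w i) = e i.
  exact: ring_paintE.
have predN i : i <= n -> ring_pred i <= n by case: i => //= i; exact: ltnW.
have Xidx v : v \in X -> exists2 i, i <= n & v = w i.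
  by move=> /Xz; exact: ring_memE.
have zK v : v \in h :: t -> v \notin X -> v \notin K.
  by move=> vz; apply: contra; exact: zX.
have notU x : x \in h :: t -> x \notin K :\: X.
  by move=> xz; rewrite inE; apply/negP => /andP[xX /(zX x xz)]; exact/negP.
have Uz : [disjoint K :\: X & h :: t].
  rewrite disjoint_subset; apply/subsetP => v vU; rewrite inE.
  by apply: contraL vU; exact: notU.
have adj_pred i : i <= n -> adj (w i) (w (ring_pred i)).
  case: i => [|i] iN /=; rewrite adjC; last exact: (ring_adj ht (ltnW iN)).
  by have := ring_adj ht (leqnn n); rewrite ring_last.
have pred_paint i : i <= n -> ring_paint Phi phi (w (ring_pred i)) = Phi (ring_pred i).
  by move=> iN; apply: paint; apply: leqW; exact: predN.
have pred_edge i : i <= n -> Phi i != Phi (ring_pred i).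
  case: i => [|i] iN /=; first by rewrite -Pn eq_sym edge.
  by rewrite eq_sym edge// ltnW.
apply: (@extendable_glue _ _ L K X phi c (ring_paint Phi phi) (ring_paint e c)) => //.
- move=> v vX; rewrite /ring_paint; case: ifP => // vz.
  have [i iN vE] := ring_memE vz; rewrite vE (ring_index ht iN).
  by have [] := old i iN; rewrite // -vE.
- move=> v vX; rewrite /ring_paint; case: ifP => // vz.
  have [i iN vE] := ring_memE vz; rewrite vE (ring_index ht iN).
  by have [] := old i iN; rewrite // -vE.
- move=> v vX; have [i iN vE] := Xidx v vX; rewrite vE paint ?leqW//.
  by apply: inL; rewrite // -vE.
- move=> v u vX vu uU; have [i iN vE] := Xidx v vX.
  rewrite vE in vX vu *; rewrite paint ?leqW//.
  have [->|->] := nbr i u iN vX vu uU; first by rewrite pred_paint// pred_edge.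
  by rewrite paint// edge.
- move=> v u vX vu uK; have [i iN vE] := Xidx v vX.
  rewrite vE in vX vu *; rewrite paint ?leqW//.
  have uU : u \notin K :\: X by rewrite inE negb_and uK orbT.
  have uX : u \notin X by apply: contra uK; exact: subsetP XK u.
  have [uE|uE] := nbr i u iN vX vu uU; rewrite uE in uX *.
    by have [_ <-] := old _ (predN i iN) uX; exact: av1.
  have avoid := av2 i iN vX uX.
  move: iN; rewrite leq_eqVlt => /predU1P[iE|iN]; last first.
    by have [_ <-] := old _ iN uX.
  rewrite iE ring_last in uX avoid *.
  by have [_ <-] := old 0 (leq0n _) uX; rewrite -en.
- move=> v vX; have [i iN vE] := Xidx v vX; rewrite vE in vX *.
  rewrite cpaint ?leqW//.
  have nz : w i.+1 \in h :: t by exact: (ring_mem h (iN : i.+1 <= n.+1)).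
  have pz : w (ring_pred i) \in h :: t by apply: (ring_mem h); apply/leqW/predN.
  have [eE|eE] := eP i iN vX.
    exists (w (ring_pred i)); split; [exact: adj_pred|exact: notU|by rewrite pred_paint|].
    move=> u vu uU; have [->//|->] := nbr i u iN vX vu uU.
    by rewrite paint// eE => /eqP; rewrite eq_sym (negPf (cf i iN vX)).
  exists (w i.+1); split; [exact: (ring_adj ht iN)|exact: notU|by rewrite paint|].
  move=> u vu uU; have [->|->//] := nbr i u iN vX vu uU.
  by rewrite pred_paint// eE => /eqP; rewrite (negPf (cf i iN vX)).
- apply: (ring_components_extendable noTheta noK4 ht Uz bU tU hU).
    by move=> i iN; rewrite paint ?cpaint ?leqW// valid.
  by move=> i iN; rewrite cpaint ?leqW// cpaint//; exact: ok.
Qed.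

End RingExtension.

(** * Cycles through a pocket *)

Section RingDegrees.
Variables (G : sgraph).
Hypotheses (noTheta : theta_free G) (noK4 : K4_free G).
Variables (h : G) (t : seq G).
Hypothesis ht : is_ring (h :: t).
Local Notation n := (size t).
Local Notation w := (ring_vertex h t).
Local Notation pred := (ring_pred t).

Lemma ring_size : 1 < n.
Proof. by case/and3P: ht. Qed.

Lemma ring_inj i j : i <= n -> j <= n -> w i = w j -> i = j.
Proof. by move=> iN jN e; rewrite -(ring_index ht iN) e ring_index. Qed.

Lemma ring_pred_succ i : i <= n -> w (pred i) != w i.+1.
Proof.
have n2 := ring_size; move=> iN; apply/eqP.
move: (iN); rewrite leq_eqVlt => /predU1P[iE|iN'].
  subst i; rewrite ring_last => /ring_inj e.
  have : pred n = 0 by apply: e => //; case: (n) n2 => //= k _; exact: leqnSn.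
  by case: (n) n2 => //= k; lia.
move=> /ring_inj e; have : pred i = i.+1.
  by apply: e => //; case: (i) iN => //= k; exact: ltnW.
by case: (i) iN iN' => [|k] /=; lia.
Qed.

Lemma ring_adj_pred i : i <= n -> adj (w i) (w (pred i)).
Proof.
case: i => [|i] iN /=; rewrite adjC; last exact: (ring_adj ht (ltnW iN)).
by have := ring_adj ht (leqnn n); rewrite ring_last.
Qed.

Lemma ring_degree i : i <= n -> 1 < degree (w i).
Proof.
move=> iN; rewrite /degree.
have : [set w (pred i); w i.+1] \subset neigh (w i).
  apply/subsetP => u /set2P[]->; rewrite inE; first exact: ring_adj_pred.
  exact: (ring_adj ht).
by move/subset_leq_card; rewrite cards2 ring_pred_succ.
Qed.

Variable U : {set G}.
Hypothesis U_ring : [disjoint U & h :: t].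
Hypothesis U_boundary : boundary_in U (mem (h :: t)).

Definition wedge_at i : Prop := exists v, [/\ v \in U,
  touches (component U v) (w i) & touches (component U v) (w i.+1)].

(** Besides its two neighbours on the ring, the vertex has a neighbour in each
    of the two components. *)
Lemma ring_degree_wedges i : i < n -> wedge_at i -> wedge_at i.+1 ->
  3 < degree (w i.+1).
Proof.
move=> iN [v [vU t1 t2]] [v' [v'U t1' t2']].
have bd := component_wedge_at noTheta noK4 ht U_ring U_boundary vU (ltnW iN) t1 t2.
have /touchesP[x xD wx] := t2; have /touchesP[x' xD' wx'] := t1'.
have i1 : i <= n.+1 := leqW (ltnW iN).
have i3 : i.+2 <= n.+1 := iN.
have z1 : w i \in h :: t := ring_mem h i1.
have z3 : w i.+2 \in h :: t := ring_mem h i3.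
have out u y : u \in U -> y \in component U u -> forall j, j <= n.+1 -> y != w j.
  move=> uU yD j jn; apply: contraTneq yD => ->.
  exact: (ring_notin U_ring _ (ring_mem h jn)).
have p2 : w i != w i.+2 by exact: (ring_pred_succ iN).
have adj2 : adj (w i.+1) (w i.+2) by exact: (ring_adj ht iN).
have xx' : x != x'.
  apply/eqP => xE; have /touchesP[y yD' wy] := t2'.
  have DD : component U v' = component U v.
    by rewrite -(component_eq xD) -(component_eq xD') xE.
  rewrite DD in yD'; have := bd y (w i.+2) yD' (ring_notin U_ring _ z3).
  rewrite adjC wy => /(_ isT)/orP[]/eqP e.
    by rewrite e eqxx in p2.
  by rewrite e adj_irrefl in adj2.
have un : uniq [:: w i; w i.+2; x; x'].
  have e1 : w i != x by rewrite eq_sym; exact: (out v x vU xD i i1).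
  have e2 : w i != x' by rewrite eq_sym; exact: (out v' x' v'U xD' i i1).
  have e3 : w i.+2 != x by rewrite eq_sym; exact: (out v x vU xD i.+2 i3).
  have e4 : w i.+2 != x' by rewrite eq_sym; exact: (out v' x' v'U xD' i.+2 i3).
  rewrite !cons_uniq !in_cons in_nil !negb_or.
  by rewrite p2 xx' e1 e2 e3 e4.
rewrite /degree; have <- : #|[:: w i; w i.+2; x; x']| = 4 := card_uniqP un.
apply/subset_leq_card/subsetP => y.
rewrite !inE => /or4P[]/eqP->//.
by rewrite adjC (ring_adj ht (ltnW iN)).
Qed.

End RingDegrees.

Section PocketRing.
Variables (G : sgraph) (a b : G) (D : {set G}).
Hypotheses (ab : adj a b) (sD : spans a b D).

(** Stated by the two neighbours on the ring, which is how it is used: they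
    are the only vertices that can carry the witness. *)
Definition chordless (s : seq G) : Prop :=
  forall i u, i <= size (rcons s b) -> u \in a :: rcons s b ->
    adj (ring_vertex a (rcons s b) i) u ->
    u = ring_vertex a (rcons s b) (ring_pred (rcons s b) i) \/
    u = ring_vertex a (rcons s b) i.+1.

Lemma pocket_ring : exists s, [/\ s != [::], {subset s <= D},
  is_ring (a :: rcons s b) & chordless s].
Proof.
have [cD aD bD ta tb] := sD.
have [s0 /induced_path_exists[s ps ind]] := path_through_exists cD ta tb.
have un := induced_path_uniq (adj_neq ab) aD bD ps ind.
have [s_ne sub pth] := ps.
have rg : is_ring (a :: rcons s b).
  rewrite /is_ring un /= rcons_path pth last_rcons adjC ab size_rcons /= !ltnS.
  by rewrite lt0n size_eq0.
exists s; split=> // i u iN uz wu.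
have [j jN uE] := ring_memE uz; rewrite uE in wu *.
have chord k l : k < l -> l <= size (rcons s b) ->
    adj (ring_vertex a (rcons s b) k) (ring_vertex a (rcons s b) l) ->
    l = k.+1 \/ (k = 0 /\ l = size (rcons s b)).
  move=> kl lN; rewrite !ring_nth//; last by rewrite (leq_trans (ltnW kl)).
  rewrite size_rcons in lN *.
  move=> kl_adj; have [->|lk] := eqVneq l k.+1; first by left.
  right; have [/andP[/eqP-> /eqP->]|] := boolP ((k == 0) && (l == (size s).+1)); first by [].
  rewrite negb_and => kl0; have := ind k l; rewrite kl_adj kl0 => H.
  suff : false by []; apply: H => //; rewrite lN andbT.
  by rewrite ltn_neqAle eq_sym lk kl.
case: (ltngtP i j) wu => [ij|ji|->]; last by rewrite adj_irrefl.
  move=> /(chord _ _ ij jN)[->|[-> ->]]; [by right|by left].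
rewrite adjC => /(chord _ _ ji iN)[->|[-> ->]]; [by left|right].
by rewrite ring_last.
Qed.

End PocketRing.

Section PocketVertices.
Variables (G : sgraph) (a b : G) (s : seq G).
Local Notation t := (rcons s b).
Local Notation w := (ring_vertex a t).

Lemma pocket_last : w (size s).+1 = b.
Proof. by rewrite ring_nth ?size_rcons//= nth_rcons ltnn eqxx. Qed.

Lemma pocket_inner i : i < size s -> w i.+1 \in s.
Proof.
move=> iN; rewrite ring_nth ?size_rcons; last by lia_size s.
by rewrite /= nth_rcons iN mem_nth.
Qed.

End PocketVertices.

(** * Pieces at an edge *)

Section WedgedStep.
Variables (G : sgraph) (C : eqType) (L : G -> seq C).
Hypotheses (noTheta : theta_free G) (noK4 : K4_free G).
Hypothesis L_uniq : forall v, uniq (L v).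
Hypothesis L_size : forall v, size (L v) = (degree v).+2.

Lemma component_smaller (K X : {set G}) v : X \subset K -> X != set0 ->
  #|component (K :\: X) v| < #|K|.
Proof.
move=> XK X0; apply: leq_ltn_trans (subset_leq_card (component_sub _ _)) _.
by rewrite cardsDS// ltn_subrL card_gt0 X0 (leq_trans _ (subset_leq_card XK))// card_gt0.
Qed.

(** Since every letter avoids r, the last two letters do not conflict with the
    vertex of colour r that follows them. *)
Lemma greedy_ring m (A : nat -> seq C) F l1 l0 r : 0 < m -> r \in F -> l0 != r ->
  (forall i, i < m -> uniq (A i) /\ (size F).+2 < size (A i)) ->
  exists Phi : nat -> C, [/\ Phi 0 = l0, Phi m.+1 = r, Phi m.+2 = l0 & Phi 1 != l1] /\
    [/\ forall i, i <= m -> Phi i != Phi i.+1,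
        forall i, i < m -> Phi i.+1 \in A i,
        forall i, i < m -> Phi i.+1 \notin F &
        forall i, i < m -> Phi i != Phi i.+2].
Proof.
move=> m0 rF l0r /(@greedy_word _ m A F l1 l0)[y [y0 y1 yP]].
have notr i : i < m -> y i.+2 != r.
  by move=> im; have [_ + _ _] := yP i im; apply: contraNneq => ->.
exists (fun k => if k <= m then y k.+1 else if k == m.+1 then r else l0).
split; first split.
- by [].
- by rewrite ltnn eqxx.
- by rewrite ltnNge leqW// (_ : m.+2 == m.+1 = false)//; apply/eqP; lia.
- by rewrite m0; have [_ _ _] := yP 0 m0; rewrite y0.
split=> i im.
- rewrite im; move: im; rewrite leq_eqVlt => /predU1P[->|im].
    rewrite ltnn eqxx; case: (m) m0 notr => // k _ notr; exact: notr.
  by rewrite im; have [_ _ + _] := yP i im; rewrite eq_sym.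
- by rewrite im; have [] := yP i im.
- by rewrite im; have [] := yP i im.
- rewrite ltnW//; move: (im); rewrite leq_eqVlt => /predU1P[iE|im'].
    rewrite -iE ltnn eqxx; case: i im iE => [|i] im iE; first by rewrite y1.
    by apply: notr; exact: ltnW.
  by rewrite im'; have [_ _ _] := yP i.+1 im'; rewrite eq_sym.
Qed.

(** Let s be a chordless path from a to b through K.  If some edge of the path
    has no component, colour s greedily, let the last colour decide which of the
    two witnesses c b and d is used, and choose the inner witnesses from both
    ends.  Otherwise all lists on s have at least six colours: the colours of s
    avoid both c b and d, and the witness of b is chosen last. *)
Lemma wedged_step (K : {set G}) :
  (forall K' : {set G}, #|K'| < #|K| -> hanging_extendable L K') ->
  (forall K' : {set G}, #|K'| < #|K| -> wedged_extendable L K') ->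
  wedged_extendable L K.
Proof.
move=> IHh IHw a b phi c d ab sK bd [Q sQ dQ] nab na nb nbd cd.
have [cK aK bK ta tb] := sK.
have [s [s0 sub rg chord]] := pocket_ring ab sK.
set t := rcons s b in rg chord.
pose w := ring_vertex a t; pose m := size s.
have tn : size t = m.+1 by rewrite size_rcons.
have m0 : 0 < m by rewrite lt0n size_eq0.
pose X := [set v in s]; pose U := K :\: X.
have ab' := adj_neq ab.
have XK : X \subset K by apply/subsetP => v; rewrite inE; exact: sub.
have X0 : X != set0.
  have [x xs] : exists x, x \in s.
    by case: (s) s0 => // x s' _; exists x; rewrite mem_head.
  by apply/set0Pn; exists x; rewrite inE.
have zK v : v \in a :: t -> v \in K -> v \in X.
  rewrite inE mem_rcons inE => /or3P[/eqP->|/eqP->|]; rewrite ?(negPf aK) ?(negPf bK)//.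
  by rewrite inE.
have Xz : {subset X <= a :: t}.
  by move=> v; rewrite inE => vs; rewrite inE mem_rcons inE vs !orbT.
have bU : boundary_in U (mem (a :: t)).
  move=> x y xU yU xy /=; have [yK|yK] := boolP (y \in K).
    by apply: Xz; move: yU; rewrite inE yK andbT negbK.
  have xK : x \in K by case/setDP: xU.
  have /orP[/eqP->|/eqP->] := bd x y xK yK xy; first by rewrite inE eqxx.
  by rewrite inE mem_rcons inE eqxx orbT.
have tU v : v \in U -> exists2 x, x \in a :: t & touches (component U v) x.
  by move=> /(component_touch cK XK X0)[x xX tx]; exists x => //; exact: Xz.
have hU v : v \in U -> hanging_extendable L (component U v).
  by move=> _; apply/IHh/component_smaller.
have wU v : v \in U -> wedged_extendable L (component U v).
  by move=> _; apply/IHw/component_smaller.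
have Uz : [disjoint U & a :: t].
  rewrite disjoint_subset; apply/subsetP => v /setDP[vK vX]; rewrite inE.
  by apply: contra vX => vz; exact: zK.
have w0 : w 0 = a by [].
have wl : w m.+1 = b by exact: pocket_last.
have wll : w m.+2 = a by rewrite -tn /w ring_last.
have w_in i : i < m -> w i.+1 \in s by exact: pocket_inner.
have w_old i : i <= m.+1 -> w i \notin X -> i = 0 \/ i = m.+1.
  case: i => [|i]; first by left.
  rewrite ltnS leq_eqVlt => /predU1P[->|im]; first by right.
  by rewrite inE (w_in i im).
have w_new i : i <= m.+1 -> w i \in X -> 0 < i <= m.
  case: i => [|i] iN; first by rewrite w0 => /(subsetP XK); rewrite (negPf aK).
  move: iN; rewrite ltnS leq_eqVlt => /predU1P[->|//].
  by rewrite wl => /(subsetP XK); rewrite (negPf bK).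
(* The edge ab carries Q on its other side, and the path s as well. *)
have no_ab v : v \in U -> touches (component U v) (w m.+1) ->
    touches (component U v) (w m.+2) -> False.
  move=> vU t1 t2; have nN : m.+1 <= size t by rewrite tn.
  have [Q' sQ' Q'z] := ring_rest rg nN.
  have sD := component_spans Uz vU nN t1 t2.
  move: sQ' sD; rewrite -/w wl wll => /spans_sym sQ' /spans_sym sD.
  have [_ aQ' bQ' _ _] := sQ'.
  have Q'K : Q' \subset K.
    apply/subsetP => x xQ'; have := subsetP Q'z x xQ'.
    rewrite inE inE mem_rcons inE => /or3P[/eqP xE|/eqP xE|]; last exact: sub.
      by rewrite -xE xQ' in aQ'.
    by rewrite -xE xQ' in bQ'.
  have DK : component U v \subset K by apply: subset_trans (component_sub _ _) (subsetDl _ _).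
  apply: (noTheta ab' sD sQ' sQ).
  - rewrite disjoint_sym disjoint_subset; apply/subsetP => x xQ'; rewrite inE.
    apply/negP => xD; have := subsetP Q'z x xQ'; rewrite inE => xz.
    by have := ring_notin Uz v xz; rewrite xD.
  - by rewrite disjoint_sym; exact: disjointWr DK dQ.
  - by rewrite disjoint_sym; exact: disjointWr Q'K dQ.
pose ok Phi i c1 c2 := wedge_ok L a t U (ring_paint a t Phi phi) i c1 c2.
have core (Phi e : nat -> C) (c' : G -> C) :
    c' a = c a -> phi b != c' b ->
    Phi 0 = phi a -> Phi m.+1 = phi b -> Phi m.+2 = phi a ->
    (forall i, i <= m -> Phi i != Phi i.+1) ->
    (forall i, i < m -> Phi i.+1 \in L (w i.+1)) ->
    (forall i, i < m -> Phi i != Phi i.+2) ->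
    Phi 1 != c a -> Phi m != c' b ->
    e 0 = c a -> e m.+1 = c' b ->
    (forall i, 0 < i < m.+1 -> is_option (fun k => Phi k.-1) (fun k => Phi k.+1) i (e i)) ->
    (forall i, i < m.+1 -> ok Phi i (e i) (e i.+1)) ->
    extendable L K phi c'.
  move=> ca nb' P0 Pl Pll Pedge PL P2 Pa Pb e0 el eO eOK.
  pose e' k := if k == m.+2 then c a else e k.
  have e'E i : i <= m.+1 -> e' i = e i by move=> im; rewrite /e' ltn_eqF.
  have Pedge' i : i <= m.+1 -> Phi i != Phi i.+1.
    rewrite leq_eqVlt => /predU1P[->|im]; last exact: Pedge.
    by rewrite Pl Pll eq_sym.
  apply: (@ring_extend _ _ L noTheta noK4 a t rg K X phi c' Phi e' XK zK Xz bU tU hU wU);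
    rewrite ?tn.
  - by rewrite Pll P0.
  - by rewrite /e' eqxx /= e0.
  - move=> i im /(w_old i im)[->|->]; rewrite e'E ?leqnn//.
      by rewrite [ring_vertex _ _ _]w0 P0 e0 ca.
    by rewrite [ring_vertex _ _ _]wl Pl el.
  - exact: Pedge'.
  - move=> i im; rewrite e'E//; case: (posnP i) => [->|i0].
      by rewrite P0 e0.
    move: im; rewrite leq_eqVlt => /predU1P[->|im]; first by rewrite Pl el.
    have [|->|->] := eO i; first by rewrite i0.
      by case: i i0 im => // i _ im; rewrite eq_sym /= Pedge'// ltnW// ltnW.
    by rewrite Pedge'// ltnW.
  - move=> i u im wX wu uU; apply: (chord i u _ _ wu); first by rewrite -/t tn.
    have [uK|uK] := boolP (u \in K).
      by apply: Xz; move: uU; rewrite inE uK andbT negbK.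
    have wK := subsetP XK _ wX.
    have /orP[/eqP->|/eqP->] := bd _ u wK uK wu; first by rewrite inE eqxx.
    by rewrite inE mem_rcons inE eqxx orbT.
  - move=> i im /(w_new i im)/andP[]; case: i im => // i im _ im'.
    exact: PL.
  - move=> i im /(w_new i im)/andP[]; case: i im => // i im _ im' /=.
    exact: P2.
  - move=> i im /(w_new i im) i0m; rewrite e'E//.
    by case: i im i0m => // i im /= im'; apply: eO.
  - move=> i im /(w_new i im)/andP[]; case: i im => // i im _ im' /= wX.
    rewrite e'E; last exact: ltnW.
    have [->|iE] := w_old i (ltnW im) wX; first by rewrite e0.
    by move: im; rewrite iE ltnn.
  - move=> i im /(w_new i im)/andP[i0 im'] wX.
    rewrite e'E//; have [//|[->]] := w_old i.+1 im' wX.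
    by rewrite el.
  - move=> i; rewrite leq_eqVlt => /predU1P[->|im]; last first.
      by rewrite !e'E//; [exact: eOK|exact: ltnW].
    by move=> v vU t1 t2; case: (no_ab v vU t1 t2).
have deg i : i < m -> 3 < size (L (w i.+1)).
  by move=> im; rewrite L_size !ltnS; apply: (ring_degree rg); rewrite tn ltnS ltnW.
have twochoice Phi : Phi 0 = phi a -> Phi m.+1 = phi b -> Phi m.+2 = phi a ->
    (forall i, i <= m -> Phi i != Phi i.+1) ->
    (forall i c1 d1 d2, i <= m -> Phi i != c1 -> Phi i.+1 != d1 ->
       Phi i.+1 != d2 -> d1 != d2 -> ok Phi i c1 d1 \/ ok Phi i c1 d2) /\
    (forall i c1 d1 d2, i <= m -> Phi i.+1 != c1 -> Phi i != d1 ->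
       Phi i != d2 -> d1 != d2 -> ok Phi i d1 c1 \/ ok Phi i d2 c1).
  move=> P0 Pl Pll Pedge.
  have paint i : i <= m.+2 -> ring_paint a t Phi phi (w i) = Phi i.
    by move=> im; apply: (ring_paintE rg); rewrite ?tn// Pll P0.
  have pr i : i <= size t -> ring_paint a t Phi phi (w i) != ring_paint a t Phi phi (w i.+1).
    rewrite tn => im; rewrite !paint//; last exact: leqW.
    move: im; rewrite leq_eqVlt => /predU1P[->|im]; last exact: Pedge.
    by rewrite Pl Pll eq_sym.
  split=> i c1 d1 d2 im n1 n2 n3 n4; have iN : i <= size t by rewrite tn ltnW.
    have p0 := paint i (leqW (leqW im)).
    have p1 := paint i.+1 (leqW im : i.+1 <= m.+2).
    by apply: (wedge_ok_right noTheta noK4 rg Uz bU wU pr iN); rewrite // ?p0 ?p1.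
  have p0 := paint i (leqW (leqW im)).
  have p1 := paint i.+1 (leqW im : i.+1 <= m.+2).
  by apply: (wedge_ok_left noTheta noK4 rg Uz bU wU pr iN); rewrite // ?p0 ?p1.
have [[j [jm bare]]|full] : (exists j, j <= m /\ ~ wedge_at a t U j) \/
    forall j, j <= m -> wedge_at a t U j.
  have [ex|nex] := boolp.EM (exists j, j <= m /\ ~ wedge_at a t U j); [by left|right].
  by move=> j jm; apply: boolp.contrapT => nj; apply: nex; exists j.
- have lists i : i < m -> uniq (L (w i.+1)) /\ (size [:: phi b]).+2 < size (L (w i.+1)).
    by move=> im; split; [exact: L_uniq|exact: deg].
  have [Phi [[P0 Pl Pll P1] [Pe PL _ P2]]] :=
    greedy_ring (c a) m0 (mem_head _ _) nab lists.
  have [right left] := twochoice Phi P0 Pl Pll Pe.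
  (* The last colour on s is fixed; it differs from one of the two witnesses. *)
  pose c' := if Phi m == c b then recolor c b d else c.
  have c'b : [/\ c' a = c a, phi b != c' b & Phi m != c' b].
    rewrite /c'; case: eqVneq => [->|//]; rewrite /recolor (negPf ab') eqxx.
    by split.
  have [c'a nb' nPb] := c'b.
  have valid_opt i x : 0 < i <= m ->
      is_option (fun k => Phi k.-1) (fun k => Phi k.+1) i x -> Phi i != x.
    move=> /andP[i0 im] [->|->]; last exact: Pe.
    by case: i i0 im => // i _ im; rewrite eq_sym /= Pe// ltnW.
  have [e [e0 el eOK eO]] : exists e, [/\ e 0 = c a, e m.+1 = c' b,
      forall i, i < m.+1 -> ok Phi i (e i) (e i.+1) &
      forall i, 0 < i < m.+1 ->
        is_option (fun k => Phi k.-1) (fun k => Phi k.+1) i (e i)].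
    apply: (@pinned_choice C (ok Phi) (fun i x => Phi i != x) _ _ m.+1 j) => //.
    + by move=> c1 c2 v vU t1 t2; case: bare; exists v.
    + by rewrite P0.
    + by rewrite Pl.
    + move=> i x im vx; have im' : i < m by [].
      by apply: right => //; [exact: ltnW|rewrite eq_sym Pe// ltnW|exact: Pe|exact: P2].
    + move=> [|i] x // im vx; have im' : i < m by [].
      by apply: left => //; [rewrite eq_sym Pe// ltnW|exact: Pe|exact: P2].
  have ext : extendable L K phi c' by exact: (core Phi e).
  by move: ext; rewrite /c'; case: ifP => _; [right|left].
have lists i : i < m -> uniq (L (w i.+1)) /\
    (size [:: phi b; c b; d]).+2 < size (L (w i.+1)).
  move=> im; split; first exact: L_uniq.
  rewrite L_size !ltnS; apply: (ring_degree_wedges noTheta noK4 rg Uz bU).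
  - by rewrite tn ltnW.
  - by apply: full; exact: ltnW.
  - exact: full.
have [Phi [[P0 Pl Pll P1] [Pe PL PF P2]]] :=
  greedy_ring (c a) m0 (mem_head _ _) nab lists.
have [right _] := twochoice Phi P0 Pl Pll Pe.
have [nPc nPd] : Phi m != c b /\ Phi m != d.
  case: (m) m0 PF => // k _ /(_ k (leqnn _)).
  by rewrite !inE !negb_or => /and3P[].
(* At b the two options are the two candidates for its witness. *)
pose o1 k := if k == m.+1 then c b else Phi k.-1.
pose o2 k := if k == m.+1 then d else Phi k.+1.
have [e [e0 eP]] : exists e, e 0 = c a /\
    forall i, i < m.+1 -> ok Phi i (e i) (e i.+1) /\ is_option o1 o2 i.+1 (e i.+1).
  apply: (@forward_choice C (ok Phi) (fun i x => Phi i != x)).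
  - by rewrite P0.
  - move=> [|i] x // /andP[_ im]; rewrite /is_option /o1 /o2 eqSS.
    case: eqVneq => [->|im']; first by rewrite Pl => -[->|->].
    have {im'} im : i < m by rewrite ltn_neqAle im'.
    by case=> ->; [rewrite eq_sym Pe// ltnW|exact: Pe].
  - move=> i x im vx; rewrite /o1 /o2 eqSS.
    case: eqVneq => [iE|im']; first by apply: right => //; rewrite iE Pl.
    have {im'} im' : i < m by rewrite ltn_neqAle im'.
    by apply: right => //; [rewrite eq_sym Pe// ltnW|exact: Pe|exact: P2].
have eO i : 0 < i < m.+1 -> is_option (fun k => Phi k.-1) (fun k => Phi k.+1) i (e i).
  case: i => // i im; have [_] := eP i (ltnW im).
  by rewrite /is_option /o1 /o2 eqSS (ltn_eqF (im : i < m)).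
have eOK i : i < m.+1 -> ok Phi i (e i) (e i.+1) by move=> /eP[].
have [_] := eP m (leqnn _); rewrite /is_option /o1 /o2 eqxx => -[el|el].
  by left; exact: (core Phi e).
by right; apply: (core Phi e) => //; rewrite /recolor ?(negPf ab') ?eqxx.
Qed.

End WedgedStep.

(** * Pieces at a vertex *)

Section HangingStep.
Variables (G : sgraph) (C : eqType) (L : G -> seq C).
Hypotheses (noTheta : theta_free G) (noK4 : K4_free G).
Hypothesis L_uniq : forall v, uniq (L v).
Hypothesis L_size : forall v, size (L v) = (degree v).+2.

Lemma smallest_set (P : {set G} -> Prop) : (exists D, P D) ->
  exists2 D, P D & forall D', P D' -> #|D| <= #|D'|.
Proof.
move=> [D PD]; have [n] := ubnP #|D|; elim: n => // n IH in D PD *.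
rewrite ltnS => Dn.
have [[D' [PD' lt]]|no] := boolp.EM (exists D', P D' /\ #|D'| < #|D|).
  by apply: (IH D' PD'); exact: leq_trans lt Dn.
exists D => // D' PD'; rewrite leqNgt; apply/negP => lt.
by apply: no; exists D'.
Qed.

(** D is a proper part of D0: it meets D0 next to u, cannot leave D0, and
    misses u. *)
Lemma trapped_smaller (D D0 : {set G}) (P : pred G) u : connected_in D ->
  boundary_in D0 P -> {in D, forall v, ~~ P v} -> u \in D0 -> u \notin D ->
  touches D u -> #|D| < #|D0|.
Proof.
move=> cD bd0 DP uD0 uD /touchesP[v vD uv].
apply: proper_card; apply/properP; split; last by exists u.
apply: connected_in_trapped cD _ _.
  move=> p q /setIP[_ pD0] qD pq; apply: contraT => qD0.
  by have := DP q qD; rewrite (bd0 p q pD0 qD0 pq).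
apply/set0Pn; exists v; rewrite inE vD /=; apply: contraT => vD0.
by have := DP v vD; rewrite (bd0 u v uD0 vD0 uv).
Qed.

(** A pocket is a set wedged at an edge from x into K.  Without pockets the
    vertex x has a single neighbour in K, which is coloured alone.  Otherwise a
    ring through a smallest pocket is coloured; its first edge has no component,
    and the witnesses are chosen backwards to it from the last vertex. *)
Lemma hanging_step (K : {set G}) :
  (forall K' : {set G}, #|K'| < #|K| -> hanging_extendable L K') ->
  (forall K' : {set G}, #|K'| < #|K| -> wedged_extendable L K') ->
  hanging_extendable L K.
Proof.
move=> IHh IHw x phi c cK xK tx bd nxc.
have outK y u : y \in K -> u \notin K -> adj y u -> u = x.
  by move=> yK uK yu; exact/eqP/(bd y u).
pose pocket (D : {set G}) := exists y, [/\ y \in K, adj x y, spans x y D,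
  D \subset K & boundary_in D (pred2 x y)].
have [/smallest_set[D0 [y [yK xy sD0 D0K bd0]] minD0]|no] :=
  boolp.EM (exists D, pocket D); last first.
  have /touchesP[y yK xy] := tx.
  have yx := adj_neq xy.
  pose X := [set y].
  have XK : X \subset K by rewrite sub1set.
  have X0 : X != set0 by apply/set0Pn; exists y; rewrite inE.
  have inD u v : v \in K :\: X -> u \in component (K :\: X) v -> u \in K /\ u != y.
    move=> vU uD; have := subsetP (component_sub _ _) u uD.
    by rewrite !inE => /andP[].
  have tU v : v \in K :\: X -> touches (component (K :\: X) v) y.
    by move=> /(component_touch cK XK X0)[u /set1P->].
  have outU v p q : v \in K :\: X -> p \in component (K :\: X) v ->
      q \notin component (K :\: X) v -> adj p q -> q = y \/ (q = x /\ q \notin K).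
    move=> vU pD qD pq; have := component_boundary pD qD pq.
    rewrite !inE negb_and negbK => /orP[/eqP->|qK]; first by left.
    by right; split=> //; have [pK _] := inD p v vU pD; exact: outK pK qK pq.
  (* A second neighbour of x in K would lie in a pocket at the edge xy. *)
  have only u : u \in K -> adj x u -> u = y.
    move=> uK xu; apply/eqP; apply: contraT => uy; case: no.
    have uU : u \in K :\: X by rewrite !inE uy uK.
    have uD := component_self uU.
    exists (component (K :\: X) u); exists y; split=> //.
    - split; [exact: connected_in_component| | |by apply/touchesP; exists u|exact: tU].
        by apply: contra xK => /(inD _ _ uU)[].
      by apply/negP => /(inD _ _ uU)[_]; rewrite eqxx.
    - by apply: subset_trans (component_sub _ _) (subsetDl _ _).
    - by move=> p q pD qD pq /=; case: (outU u p q uU pD qD pq) => [->|[-> _]];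
        rewrite eqxx ?orbT.
  have [|col colL] := @pick_avoiding _ (L y) [:: phi x; c x] (L_uniq y).
    rewrite L_size !ltnS; apply/card_gt0P; exists x.
    by rewrite inE adjC.
  rewrite !inE !negb_or => /andP[colx colc].
  have nbr w : adj y w -> w \notin K :\: X -> w = x.
    move=> yw; rewrite !inE negb_and negbK => /orP[/eqP wy|wK].
      by move: yw; rewrite wy adj_irrefl.
    exact: outK yK wK yw.
  apply: (@extendable_glue _ _ L K X phi c (recolor phi y col) (recolor c y (phi x))) => //.
  - by move=> v; rewrite inE /recolor => /negPf->.
  - by move=> v; rewrite inE /recolor => /negPf->.
  - by move=> v /set1P->; rewrite /recolor eqxx.
  - move=> v w /set1P-> yw wU; rewrite (nbr w yw wU) /recolor eqxx (negPf yx).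
    exact: colx.
  - move=> v w /set1P-> yw wK; rewrite (outK y w yK wK yw) /recolor eqxx.
    exact: colc.
  - move=> v /set1P->; exists x; split; first by rewrite adjC.
    + by rewrite inE negb_and xK orbT.
    + by rewrite /recolor eqxx (negPf yx).
    + by move=> w yw wU _; exact: nbr.
  - move=> v vU; apply: (IHh _ (component_smaller v XK X0) y).
    + exact: connected_in_component.
    + by apply/negP => /(inD _ _ vU)[_]; rewrite eqxx.
    + exact: tU.
    + move=> p q pD qD pq; have [->|[qx qK]] := outU v p q vU pD qD pq.
        by rewrite /= eqxx.
      have [pK py] := inD p v vU pD; exfalso.
      by move: py; rewrite (only p pK) ?eqxx// adjC -qx.
    + by rewrite /recolor eqxx.
have [s [s0 sub rg chord]] := pocket_ring xy sD0.
set t := rcons s y in rg chord.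
pose w := ring_vertex x t; pose n := size t.
have n2 : 1 < n := ring_size rg.
pose X := [set v in t]; pose U := K :\: X.
have tK v : v \in t -> v \in K.
  by rewrite mem_rcons inE => /predU1P[->//|/sub]; exact: (subsetP D0K).
have XK : X \subset K by apply/subsetP => v; rewrite inE; exact: tK.
have X0 : X != set0 by apply/set0Pn; exists y; rewrite inE mem_rcons mem_head.
have zK v : v \in x :: t -> v \in K -> v \in X.
  by rewrite [v \in X]inE inE => /predU1P[->|//]; rewrite (negPf xK).
have Xz : {subset X <= x :: t} by move=> v; rewrite inE => vs; rewrite inE vs orbT.
have bU : boundary_in U (mem (x :: t)).
  move=> p q pU qU pq /=; have [qK|qK] := boolP (q \in K).
    by apply: Xz; move: qU; rewrite inE qK andbT negbK.
  have pK : p \in K by case/setDP: pU.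
  by rewrite (outK p q pK qK pq) inE eqxx.
have tU v : v \in U -> exists2 u, u \in x :: t & touches (component U v) u.
  by move=> /(component_touch cK XK X0)[u uX tu]; exists u => //; exact: Xz.
have hU v : v \in U -> hanging_extendable L (component U v).
  by move=> _; apply/IHh/component_smaller.
have wU v : v \in U -> wedged_extendable L (component U v).
  by move=> _; apply/IHw/component_smaller.
have Uz : [disjoint U & x :: t].
  rewrite disjoint_subset; apply/subsetP => v /setDP[vK vX]; rewrite inE.
  by apply: contra vX => vz; exact: zK.
have w0 : w 0 = x by [].
have wl : w n.+1 = x by exact: ring_last.
have w_new i : 0 < i <= n -> w i \in X.
  move=> /andP[i0 im]; apply: zK; first exact/ring_mem/leqW.
  have := ring_mem x (leqW im); rewrite inE => /predU1P[e|]; last exact: tK.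
  by rewrite (ring_inj rg im (leq0n _) (e : w i = w 0)) in i0.
have w_old i : i <= n -> w i \notin X -> i = 0.
  by case: i => // i im /negP[]; exact: w_new.
(* A component at the edge from x to w 1 would be a smaller pocket. *)
have bare v : v \in U -> touches (component U v) (w 0) ->
    touches (component U v) (w 1) -> False.
  move=> vU t0 t1.
  have w1D0 : w 1 \in D0.
    by apply/sub/pocket_inner; rewrite lt0n size_eq0.
  have DU := subsetP (component_sub U v).
  have w1X : w 1 \in X by apply: w_new; rewrite (ltnW n2).
  have lt : #|component U v| < #|D0|.
    apply: (@trapped_smaller _ _ (pred2 x y) (w 1)) => //.
    - exact: connected_in_component.
    - move=> u /DU; rewrite inE => /andP[uX uK]; apply/negP => /orP[]/eqP uE.
        by move: uK; rewrite uE (negPf xK).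
      by move: uX; rewrite uE inE mem_rcons mem_head.
    - by apply: contraL w1X => /DU; rewrite inE => /andP[].
  move: lt; rewrite ltnNge minD0//; exists (w 1); split.
  - exact: (subsetP XK).
  - exact: (ring_adj rg (leq0n _)).
  - exact: (component_spans Uz vU (leq0n _) t0 t1).
  - by apply: subset_trans (component_sub _ _) (subsetDl _ _).
  - exact: (component_wedge_at noTheta noK4 rg Uz bU vU (leq0n _) t0 t1).
have lists i : i < n -> uniq (L (w i.+1)) /\ 3 < size (L (w i.+1)).
  by move=> im; split=> //; rewrite L_size !ltnS; apply: (ring_degree rg).
have [f [[f0 f1 fn fnn] [[f12 f02] fL]]] := word_around (c x) (phi x) n2 lists.
pose Phi k := f k.+1.
have paint i : i <= n.+1 -> ring_paint x t Phi phi (w i) = Phi i.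
  by apply: (ring_paintE rg); rewrite /Phi fn f1.
have pr i : i <= size t -> ring_paint x t Phi phi (w i) != ring_paint x t Phi phi (w i.+1).
  by move=> im; rewrite !paint//; [exact: f12|exact: leqW].
pose ok i c1 c2 := wedge_ok L x t U (ring_paint x t Phi phi) i c1 c2.
have right i c1 d1 d2 : i <= n -> Phi i != c1 -> Phi i.+1 != d1 ->
    Phi i.+1 != d2 -> d1 != d2 -> ok i c1 d1 \/ ok i c1 d2.
  move=> im n1 n2' n3 n4; have p0 := paint i (leqW im).
  have p1 := paint i.+1 im.
  by apply: (wedge_ok_right noTheta noK4 rg Uz bU wU pr im); rewrite // ?p0 ?p1.
have left i c1 d1 d2 : i <= n -> Phi i.+1 != c1 -> Phi i != d1 ->
    Phi i != d2 -> d1 != d2 -> ok i d1 c1 \/ ok i d2 c1.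
  move=> im n1 n2' n3 n4; have p0 := paint i (leqW im).
  have p1 := paint i.+1 im.
  by apply: (wedge_ok_left noTheta noK4 rg Uz bU wU pr im); rewrite // ?p0 ?p1.
have valid_opt i v : 0 < i < n.+1 ->
    is_option (fun k => Phi k.-1) (fun k => Phi k.+1) i v -> Phi i != v.
  move=> /andP[i0 im] [->|->]; last exact: f12.
  by case: i i0 im => // i _ im; rewrite eq_sym /= f12// ltnW.
have [e [e0 el eOK eO]] : exists e, [/\ e 0 = c x, e n.+1 = c x,
    forall i, i < n.+1 -> ok i (e i) (e i.+1) &
    forall i, 0 < i < n.+1 ->
      is_option (fun k => Phi k.-1) (fun k => Phi k.+1) i (e i)].
  apply: (@pinned_choice C ok (fun i v => Phi i != v) _ _ n.+1 0) => //.
  - by move=> c1 c2 v vU t0 t1; case: (bare v vU t0 t1).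
  - by rewrite /Phi f1.
  - by rewrite /Phi fn.
  - move=> i v im vv; have im' : i < n by [].
    apply: right => //; [exact: ltnW|rewrite eq_sym; exact/f12/ltnW|exact: f12|].
    by apply: f02; rewrite ltnS ltnW.
  - move=> [|i] v // im vv; have im' : i < n by [].
    apply: left => //; [rewrite eq_sym; exact/f12/ltnW|exact: f12|].
    by apply: f02; rewrite ltnS ltnW.
apply: (@ring_extend _ _ L noTheta noK4 x t rg K X phi c Phi e XK zK Xz bU tU hU wU).
- by rewrite /Phi fn f1.
- by rewrite el e0.
- by move=> i im /(w_old i im)->; rewrite e0 /Phi f1.
- by move=> i im; exact: f12.
- move=> [|i] im; first by rewrite e0 /Phi f1.
  by apply: valid_opt (eO _ _); rewrite ltnS.
- move=> i u im wX wu uU; apply: (chord i u im _ wu).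
  have [uK|uK] := boolP (u \in K).
    by apply: Xz; move: uU; rewrite inE uK andbT negbK.
  by rewrite (outK _ u (subsetP XK _ wX) uK wu) inE eqxx.
- move=> [|i] im wX; first by move: wX => /(subsetP XK); rewrite [ring_vertex _ _ _]w0 (negPf xK).
  exact: fL.
- move=> [|i] im wX; first by move: wX => /(subsetP XK); rewrite [ring_vertex _ _ _]w0 (negPf xK).
  by apply: f02; rewrite ltnS ltnW.
- move=> [|i] im wX; first by move: wX => /(subsetP XK); rewrite [ring_vertex _ _ _]w0 (negPf xK).
  by apply: eO; rewrite ltnS.
- move=> [|i] im wX; first by move: wX => /(subsetP XK); rewrite [ring_vertex _ _ _]w0 (negPf xK).
  move=> /= /(w_old i (ltnW im)) ->; rewrite e0 /Phi -f0 eq_sym.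
  exact: (f02 0).
- move=> i im wX wX'; move: im; rewrite leq_eqVlt => /predU1P[->|im].
    by rewrite el /Phi -fnn; apply: f02.
  by have := w_old i.+1 im wX'.
- by move=> i im; exact: eOK.
Qed.

Lemma pieces_extendable (K : {set G}) :
  hanging_extendable L K /\ wedged_extendable L K.
Proof.
have [k] := ubnP #|K|; elim: k => // k IH in K *; rewrite ltnS => Kk.
have lt K' : #|K'| < #|K| -> #|K'| < k by move=> /leq_trans; apply.
split; [apply: hanging_step|apply: wedged_step] => // K' /lt/IH[] //.
Qed.

End HangingStep.

(** * The whole graph *)

(** Greedy choice in the order of s: the i-th element has i predecessors. *)
Lemma distinct_choice (C : eqType) (A : nat -> seq C) (x0 : C) (s : seq nat) :
  (forall i, i \in s -> uniq (A i)) ->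
  (forall i, i < size s -> i < size (A (nth 0 s i))) -> uniq s ->
  exists f : nat -> C, (forall i, i \in s -> f i \in A i) /\ {in s &, injective f}.
Proof.
elim/last_ind: s => [|s k IH] uA sA us; first by exists (fun=> x0).
move: us; rewrite rcons_uniq => /andP[ks us].
have [||//|f [fA finj]] := IH.
- by move=> i is_; apply: uA; rewrite mem_rcons inE is_ orbT.
- move=> i is_; have := sA i; rewrite size_rcons nth_rcons is_.
  by apply; exact: leqW.
have [||x xA xf] := @pick_avoiding _ (A k) (map f s).
- by apply: uA; rewrite mem_rcons mem_head.
- rewrite size_map; have := sA (size s); rewrite size_rcons nth_rcons ltnn eqxx.
  by apply.
have kf i : i \in s -> i == k = false by move=> is_; apply: contraNF ks => /eqP <-.
exists (fun i => if i == k then x else f i); split.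
  move=> i; rewrite mem_rcons inE; case: eqVneq => [->//|_ /=]; exact: fA.
move=> i j; rewrite !mem_rcons !inE.
case: (eqVneq i k) => [->|_] /=; case: (eqVneq j k) => [->|_] //=.
- by move=> _ js xE; move: xf; rewrite xE map_f.
- by move=> is_ _ xE; move: xf; rewrite -xE map_f.
- exact: finj.
Qed.

Section FiveRing.
Variables (G : sgraph) (a b : G) (s : seq G).
Hypotheses (rg : is_ring (a :: rcons s b)) (chord : chordless a b s).
Hypotheses (s3 : size s = 3) (all_ring : forall v, v \in a :: rcons s b).
Local Notation w := (ring_vertex a (rcons s b)).

Lemma five_ring_C5 : graph_iso G C5.
Proof.
have tn : size (rcons s b) = 4 by rewrite size_rcons s3.
pose f (v : G) : 'I_5 := inord (index v (a :: rcons s b)).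
have idx (v : G) : exists2 i, i <= 4 & v = w i.
  by have [i] := ring_memE (all_ring v); rewrite tn; exists i.
have fw i : i <= 4 -> f (w i) = inord i.
  by move=> i4; rewrite /f (ring_index rg) ?tn.
have wS i : i <= 4 -> w i.+1 = w (i.+1 %% 5).
  rewrite leq_eqVlt => /predU1P[->|i4]; last by rewrite modn_small.
  by rewrite -[4]tn ring_last tn.
exists f.
  exists (fun i : 'I_5 => w i) => [v|i].
    by have [i i4 ->] := idx v; rewrite fw// inordK.
  by rewrite fw ?inord_val// -ltnS.
move=> u v; have [i i4 ->] := idx u; have [j j4 ->] := idx v.
rewrite !fw//=; have ordE k l : k <= 4 -> l <= 4 ->
    (inord l == ordS (inord k : 'I_5)) = (w l == w k.+1).
  move=> k4 l4; rewrite wS// -val_eqE /= !inordK//.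
  apply/eqP/eqP => [->//|/(ring_inj rg)].
  by apply; rewrite tn// -ltnS ltn_mod.
rewrite /C5_adj /= !ordE//; apply/idP/idP.
  case/orP=> /eqP->; last rewrite adjC; by apply: (ring_adj rg); rewrite tn.
move=> ij; have iN : i <= size (rcons s b) by rewrite tn.
have [e|->] := chord iN (all_ring _) ij; last by rewrite eqxx.
have pN : ring_pred (rcons s b) i <= size (rcons s b).
  by case: (i) iN => //= k; exact: ltnW.
have jN : j <= size (rcons s b) by rewrite tn.
rewrite (ring_inj rg jN pN e); apply/orP; right; apply/eqP.
by case: (i) => [|k] //=; rewrite ring_last.
Qed.

End FiveRing.

Section Root.
Variables (G : sgraph) (C : eqType) (L : G -> seq C).
Hypotheses (noTheta : theta_free G) (noK4 : K4_free G).
Hypothesis L_uniq : forall v, uniq (L v).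
Hypothesis L_size : forall v, size (L v) = (degree v).+2.
Hypothesis G_conn : connected_in [set: G].

(** No component of the rest touches both ends of ab, so that all of them
    hang. *)
Lemma tree_root (a b : G) (phi c : G -> C) : adj a b ->
  (forall D, spans a b D -> ~ boundary_in D (pred2 a b)) ->
  extendable L [set: G] phi c.
Proof.
move=> ab no; have ab' := adj_neq ab.
have [alpha alphaL _] := @pick_avoiding _ (L a) [::] (L_uniq a) ltac:(by rewrite L_size).
have [beta betaL] := @pick_avoiding _ (L b) [:: alpha] (L_uniq b) ltac:(by rewrite L_size).
rewrite inE => beta_alpha.
pose X := [set a; b]; pose U := [set: G] :\: X.
have UE v : (v \in U) = (v \notin X) by rewrite !inE andbT.
have X0 : X != set0 by apply/set0Pn; exists a; rewrite !inE eqxx.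
have DX v u : u \in component U v -> (u != a) && (u != b).
  by move=> /(subsetP (component_sub _ _)); rewrite !inE andbT negb_or.
have bD v : boundary_in (component U v) (pred2 a b).
  by move=> p q pD qD /(component_boundary pD qD); rewrite UE negbK !inE.
have tD v : v \in U -> exists2 x, x \in X & touches (component U v) x.
  exact: (component_touch G_conn (subsetT X) X0).
have [nDa nDb] : (forall v, a \notin component U v) /\ (forall v, b \notin component U v).
  by split=> v; apply/negP => /DX; rewrite eqxx ?andbF.
pose phi' := recolor (recolor phi b beta) a alpha.
pose c' := recolor (recolor c b alpha) a beta.
have [pa pb ca cb] : [/\ phi' a = alpha, phi' b = beta, c' a = beta & c' b = alpha].
  by rewrite /phi' /c' /recolor !eqxx eq_sym (negPf ab').
have off (g : G -> C) x y v : v \notin X -> recolor (recolor g b x) a y v = g v.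
  by rewrite !inE negb_or /recolor => /andP[/negPf-> /negPf->].
apply: (@extendable_glue _ _ L _ X phi c phi' c' (subsetT X)).
- by move=> v; exact: off.
- by move=> v; exact: off.
- by move=> v /set2P[]->; rewrite ?pa ?pb.
- move=> v w /set2P[]-> vw; rewrite UE negbK => /set2P[]wE;
    rewrite wE ?adj_irrefl// in vw *; by rewrite ?pa ?pb// eq_sym.
- by move=> v w _ _; rewrite inE.
- move=> v /set2P[]->.
    exists b; split=> //; rewrite ?UE ?negbK ?pb ?ca ?inE ?eqxx ?orbT//.
    by move=> w aw; rewrite UE negbK => /set2P[]// wE; rewrite wE adj_irrefl in aw.
  exists a; split=> //; rewrite ?UE ?negbK ?pa ?cb ?inE ?eqxx//; first by rewrite adjC.
  by move=> w aw; rewrite UE negbK => /set2P[]// wE; rewrite wE adj_irrefl in aw.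
- move=> v vU; have [hang _] := pieces_extendable noTheta noK4 L_uniq L_size (component U v).
  have conn := @connected_in_component _ U v.
  have one x y : boundary_in (component U v) (pred2 x y) ->
      ~~ touches (component U v) y -> boundary_in (component U v) (pred1 x).
    move=> bd nt p q pD qD pq; have /orP[//|/eqP qy] := bd p q pD qD pq.
    by case/touchesP: nt; exists p; rewrite // adjC -qy.
  have bD' : boundary_in (component U v) (pred2 b a).
    by move=> p q pD qD pq; have := bD v p q pD qD pq; rewrite /= orbC.
  have [ta|ta] := boolP (touches (component U v) a).
    apply: (hang a) => //; last by rewrite pa ca eq_sym.
    apply: one (bD v) _; apply/negP => tb; apply: no (bD v).
    by split.
  have [x /set2P[]-> tx] := tD v vU; first by rewrite tx in ta.
  apply: (hang b) => //; last by rewrite pb cb.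
  exact: one bD' ta.
Qed.

(** For a ring of length five the vertex of degree at least three is coloured
    last. *)
Lemma ring_colors (a b : G) (s : seq G) :
  let t := rcons s b in let n := size t in let w := ring_vertex a t in
  s != [::] -> is_ring (a :: t) ->
  (size s = 3 -> exists2 i, i <= 4 & 2 < degree (w i)) ->
  exists Phi : nat -> C, [/\ Phi n.+1 = Phi 0,
    forall i, i <= n -> Phi i \in L (w i),
    forall i, i <= n -> Phi i != Phi i.+1 &
    forall i, i <= n -> Phi (ring_pred t i) != Phi i.+1].
Proof.
move=> t n w s0 rg big.
have nE : n = (size s).+1 by rewrite /n size_rcons.
have w0 : w 0 = a by [].
have wn : w n = b by rewrite nE; exact: pocket_last.
have sL i : i <= n -> 4 <= size (L (w i)).
  by move=> iN; rewrite L_size !ltnS; exact: (ring_degree rg).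
have [alpha alphaL _] := @pick_avoiding _ (L a) [::] (L_uniq a) ltac:(by rewrite L_size).
have [/eqP m3|m3] := boolP (size s == 3).
  have [k k4 dk] := big m3.
  have n4 : n = 4 by rewrite nE m3.
  have kI : k \in iota 0 5 by rewrite mem_iota.
  (* The vertex k has a list of at least five colours, so it comes last. *)
  pose r := rcons (rem k (iota 0 5)) k.
  have rI : perm_eq r (iota 0 5).
    by rewrite /r perm_rcons perm_sym perm_to_rem.
  have szr : size (rem k (iota 0 5)) = 4 by rewrite size_rem.
  have mr i : (i \in r) = (i <= 4) by rewrite (perm_mem rI) mem_iota.
  have [|||f [fL finj]] := @distinct_choice _ (fun i => L (w i)) alpha r.
  - by move=> i _; exact: L_uniq.
  - move=> i; rewrite /r size_rcons szr nth_rcons szr ltnS leq_eqVlt => /predU1P[->|i4].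
      by rewrite ltnn eqxx L_size !ltnS.
    rewrite i4; apply: (leq_trans i4).
    have ir : nth 0 (rem k (iota 0 5)) i \in r.
      rewrite /r mem_rcons in_cons; apply/orP; right.
      by apply: mem_nth; rewrite szr.
    by apply: sL; rewrite n4 -mr.
  - by rewrite (perm_uniq rI) iota_uniq.
  have neq i j : i <= 4 -> j <= 4 -> i != j -> f i != f j.
    by move=> i4 j4; apply: contra_neq => /finj; rewrite !mr; apply.
  exists (fun i => if i == 5 then f 0 else f i); rewrite n4; split=> //.
  - by move=> i i4; rewrite ltn_eqF//; apply: fL; rewrite mr.
  - by case=> [|[|[|[|[|?]]]]] //= _; exact: neq.
  - by case=> [|[|[|[|[|?]]]]] //= _; rewrite -/n ?n4 /=; exact: neq.
have [beta betaL] := @pick_avoiding _ (L b) [:: alpha] (L_uniq b) ltac:(by rewrite L_size).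
rewrite inE eq_sym => ab.
have m0 : 0 < size s by rewrite lt0n size_eq0.
have [|y [[y0 y1 yr yrr] [[y12 y02] yL]]] :=
    @word_cycle _ (size s) (fun i => L (w i.+1)) alpha beta m0 m3 ab.
  by move=> i im; split; [exact: L_uniq|apply: sL; rewrite nE ltnS ltnW].
exists (fun k => y k.+1); split.
- by rewrite nE yrr y1.
- move=> [|i] iN; first by rewrite w0 y1.
  move: iN; rewrite nE ltnS leq_eqVlt => /predU1P[->|im]; last exact: yL.
  by rewrite yr -nE wn.
- move=> i; rewrite nE leq_eqVlt => /predU1P[->|im]; last exact: y12.
  by rewrite yr yrr eq_sym.
- move=> [|i] iN /=; last by apply: y02; rewrite -nE.
  by rewrite -/n nE yr -y0; exact: (y02 0).
Qed.

(** In a ring through a smallest pocket D0 at ab, a component at an edge other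
    than ab would be a smaller pocket.  So only the edge from b to a needs a
    choice of witnesses. *)
Lemma ring_root (phi c : G -> C) : ~ graph_iso G C5 ->
  (exists (a b : G) (D : {set G}),
    [/\ adj a b, spans a b D & boundary_in D (pred2 a b)]) ->
  extendable L [set: G] phi c.
Proof.
move=> nC5 [a1 [b1 [D1 [ab1 sD1 bD1]]]].
pose pocket (D : {set G}) := exists a b : G,
  [/\ adj a b, spans a b D & boundary_in D (pred2 a b)].
have [D0 [a [b [ab sD0 bD0]]] minD0] : exists2 D, pocket D &
    forall D', pocket D' -> #|D| <= #|D'|.
  by apply: smallest_set; exists D1, a1, b1.
have [s [s0 sub rg chord]] := pocket_ring ab sD0.
set t := rcons s b in rg chord.
pose w := ring_vertex a t; pose n := size t.
have nE : n = (size s).+1 by rewrite /n size_rcons.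
pose X := [set v in a :: t]; pose U := [set: G] :\: X.
have UE v : (v \in U) = (v \notin a :: t).
  by rewrite in_setD in_setT andbT [v \in X]inE.
have X0 : X != set0 by apply/set0Pn; exists a; rewrite inE mem_head.
have bU : boundary_in U (mem (a :: t)).
  by move=> p q _; rewrite UE negbK.
have tU v : v \in U -> exists2 x, x \in a :: t & touches (component U v) x.
  move=> /(component_touch G_conn (subsetT X) X0)[x].
  by rewrite inE => xz tx; exists x.
have hU v : v \in U -> hanging_extendable L (component U v).
  by move=> _; have [] := pieces_extendable noTheta noK4 L_uniq L_size (component U v).
have wU v : v \in U -> wedged_extendable L (component U v).
  by move=> _; have [] := pieces_extendable noTheta noK4 L_uniq L_size (component U v).
have Uz : [disjoint U & a :: t].
  by rewrite disjoint_subset; apply/subsetP => v; rewrite UE inE.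
have w_mem i : i <= n -> w i \in a :: t by move=> iN; exact/ring_mem/leqW.
have big : size s = 3 -> exists2 i, i <= 4 & 2 < degree (w i).
  move=> s3; apply: boolp.contrapT => small; apply: nC5.
  have n4 : n = 4 by rewrite nE s3.
  apply: (five_ring_C5 rg chord s3) => v.
  have nbr i u : i <= 4 -> adj (w i) u -> u \in a :: t.
    move=> i4 wu; have iN : i <= n by rewrite n4.
    have d2 : degree (w i) <= 2 by rewrite leqNgt; apply/negP => d3; apply: small; exists i.
    have pz : w (ring_pred t i) \in a :: t.
      by apply: w_mem; case: (i) iN => //= k; exact: ltnW.
    have sz : w i.+1 \in a :: t by exact: (ring_mem a (iN : i.+1 <= n.+1)).
    apply: contraT => uz; move: d2; rewrite leqNgt => /negP[].
    have un : uniq [:: w (ring_pred t i); w i.+1; u].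
      rewrite /= !inE !negb_or (ring_pred_succ rg iN) /= andbT.
      by apply/andP; split; apply: contraNneq uz => <-.
    rewrite /degree; have <- : #|[:: w (ring_pred t i); w i.+1; u]| = 3 := card_uniqP un.
    apply/subset_leq_card/subsetP => x; rewrite !inE => /or3P[]/eqP->//.
      exact: ring_adj_pred.
    exact: (ring_adj rg).
  have XT : [set: G] \subset X.
    apply: connected_in_trapped G_conn _ _.
      move=> p q; rewrite setTI inE => pz _ pq; rewrite inE.
      have [i iN pE] := ring_memE pz; rewrite pE in pq.
      by apply: (nbr i q _ pq); rewrite -n4.
    by rewrite setTI.
  by have := subsetP XT v; rewrite !inE => /(_ isT).
have [Phi [Pn PL Pe P2]] := ring_colors s0 rg big.
rewrite -/t -/n -/w in Pn PL Pe P2.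
pose ok i c1 c2 := wedge_ok L a t U (ring_paint a t Phi phi) i c1 c2.
have paint i : i <= n.+1 -> ring_paint a t Phi phi (w i) = Phi i.
  exact: (ring_paintE rg).
have pr i : i <= size t -> ring_paint a t Phi phi (w i) != ring_paint a t Phi phi (w i.+1).
  by move=> iN; rewrite !paint//; [exact: Pe|exact: leqW].
have w_in i : i < size s -> w i.+1 \in D0 by move=> im; exact/sub/pocket_inner.
have m0 : 0 < size s by rewrite lt0n size_eq0.
have ok_inner i c1 c2 : i < n -> ok i c1 c2.
  move=> iN v vU t1 t2; exfalso; have iN' := ltnW iN.
  have DU := subsetP (component_sub U v).
  have lt u : u \in D0 -> u \in a :: t -> touches (component U v) u -> #|component U v| < #|D0|.
    move=> uD0 uz tu; apply: (@trapped_smaller _ _ _ (pred2 a b) u) => //.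
    - exact: connected_in_component.
    - move=> x /DU; rewrite UE; apply: contra => /orP[]/eqP->; rewrite !inE ?eqxx//.
      by rewrite mem_rcons inE eqxx orbT.
    - by apply/negP => /DU; rewrite UE uz.
  have {}lt : #|component U v| < #|D0|.
    case: i iN iN' t1 t2 => [|i] iN iN' t1 t2.
      by apply: (lt (w 1)) => //; [exact: w_in|exact: w_mem].
    apply: (lt (w i.+1)) => //; [apply: w_in|exact: w_mem].
    by rewrite nE in iN.
  move: lt; rewrite ltnNge minD0//; exists (w i), (w i.+1); split.
  - exact: (ring_adj rg).
  - exact: (component_spans Uz vU iN' t1 t2).
  - exact: (component_wedge_at noTheta noK4 rg Uz bU vU iN' t1 t2).
(* The witness of a is the colour of the vertex after it; that of b is chosen
   to suit the component at the edge from b to a. *)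
have [x xO okx] : exists2 x, x = Phi n.-1 \/ x = Phi n.+1 & ok n x (Phi 1).
  have n1 : n = n.-1.+1 by rewrite nE.
  have [p0 p1] := (paint n (leqnSn n), paint n.+1 (leqnn _)).
  have [||||o|o] := @wedge_ok_left _ _ L noTheta noK4 a t rg U Uz bU wU _ pr n
      (Phi 1) (Phi n.-1) (Phi n.+1) (leqnn n).
  - by rewrite p1 Pn; exact: (Pe 0).
  - by rewrite p0 {1}n1 eq_sym Pe// {2}n1.
  - by rewrite p0 Pe.
  - by have := P2 n (leqnn n); rewrite {1}n1.
  - by exists (Phi n.-1) => //; left.
  - by exists (Phi n.+1) => //; right.
pose e k := if k == n then x else if k == n.+1 then Phi 1 else Phi k.+1.
have n0 : 0 < n by rewrite nE.
have eS : e n.+1 = Phi 1 by rewrite /e eqxx gtn_eqF.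
have e0 : e 0 = Phi 1 by rewrite /e ltn_eqF.
have en : e n = x by rewrite /e eqxx.
have ei i : i < n -> e i = Phi i.+1.
  by move=> iN; rewrite /e ltn_eqF// ltn_eqF// leqW.
have wX i : i <= n -> w i \in X by move=> iN; rewrite inE; exact: w_mem.
have eP i : i <= n -> e i = Phi (ring_pred t i) \/ e i = Phi i.+1.
  rewrite leq_eqVlt => /predU1P[->|iN]; last by right; exact: ei.
  by rewrite en; case: xO => ->; [left; rewrite nE|right].
apply: (@ring_extend _ _ L noTheta noK4 a t rg _ X phi c Phi e (subsetT X) _ _ bU tU hU wU).
- by move=> v vz _; rewrite inE.
- by move=> v; rewrite inE.
- exact: Pn.
- by rewrite eS e0.
- by move=> i iN; rewrite (wX i iN).
- exact: Pe.
- move=> i iN; have [->|->] := eP i iN; last exact: Pe.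
  case: i iN => [|i] iN /=; first by rewrite -Pn eq_sym; exact: Pe.
  by rewrite eq_sym; apply/Pe/ltnW.
- by move=> i u iN _ wu; rewrite UE negbK => uz; exact: chord.
- by move=> i iN _; exact: PL.
- by move=> i iN _; exact: P2.
- by move=> i iN _; exact: eP.
- move=> i iN _ /negP[]; apply: wX.
  by case: (i) iN => //= k; exact: ltnW.
- move=> i iN _ /negP[]; rewrite inE.
  exact: (ring_mem a (iN : i.+1 <= n.+1)).
- move=> i; rewrite leq_eqVlt => /predU1P[->|iN]; last exact: ok_inner.
  by rewrite en eS.
Qed.

Lemma list_colorable : ~ graph_iso G C5 ->
  exists psi : G -> C, [/\ forall v, psi v \in L v,
    forall u v, adj u v -> psi u != psi v &
    forall v, 0 < degree v -> conflict_free_at psi v].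
Proof.
move=> nC5.
have [[a [b ab]]|no] := boolp.EM (exists a b : G, adj a b); last first.
  have /boolp.choice[psi psiL] : forall v, exists x, x \in L v.
    move=> v; have [|x xL _] := @pick_avoiding _ (L v) [::] (L_uniq v).
      by rewrite L_size.
    by exists x.
  exists psi; split=> // [u v uv|v /card_gt0P[u]]; first by case: no; exists u, v.
  by rewrite inE => vu; case: no; exists v, u.
have [x0 _ _] := @pick_avoiding _ (L a) [::] (L_uniq a) ltac:(by rewrite L_size).
suff [psi [_ p_L p_prop p_cf _]] : extendable L [set: G] (fun=> x0) (fun=> x0).
  exists psi; split.
  - by move=> v; apply: p_L; rewrite inE.
  - by move=> u v; apply: p_prop; rewrite inE.
  - by move=> v _; apply: p_cf; rewrite inE.
have [[D [sD bD]]|nD] := boolp.EM (exists D : {set G}, spans a b D /\ boundary_in D (pred2 a b)).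
  by apply: ring_root => //; exists a, b, D.
by apply: (tree_root _ _ ab) => D sD bD; apply: nD; exists D.
Qed.

End Root.

From mathcomp Require Import all_classical all_reals all_analysis.
From mathcomp Require Import ring lra.

Import Order.TTheory GRing.Theory Num.Theory.
Import numFieldNormedType.Exports.

(** * Winding numbers of fine chains *)

Section Winding.
Variable R : realType.
Local Open Scope ring_scope.
Implicit Types (p q r u g : R * R) (s t : seq (R * R)) (d : R).

(** The quadrants are half-open, so that they partition the nonzero vectors and
    are permuted by the central symmetry. *)
Definition quadrant g : nat :=
  if (0 < g.1) && (0 <= g.2) then 0%N
  else if (g.1 <= 0) && (0 < g.2) then 1%N
  else if (g.1 < 0) && (g.2 <= 0) then 2%N else 3%N.

(** The signed number of quarter turns from quadrant i to quadrant j.  Between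
    opposite quadrants it has no meaning; its value there is only relevant
    modulo four. *)
Definition turn (i j : nat) : int :=
  if ((j + 4 - i) %% 4 == 3)%N then -1 else ((j + 4 - i) %% 4)%N%:Z.

(** Quarter turns of the vector from u to a point running along p :: s. *)
Fixpoint winding u p s : int :=
  if s is q :: s' then
    turn (quadrant (p - u)) (quadrant (q - u)) + winding u q s'
  else 0.

(** Distances are measured in the maximum norm, coordinate by coordinate. *)
Definition nearby d : rel (R * R) :=
  [rel p q | (`|p.1 - q.1| < d) && (`|p.2 - q.2| < d)].

Definition apart d : rel (R * R) :=
  [rel p q | (d <= `|p.1 - q.1|) || (d <= `|p.2 - q.2|)].

Lemma nearbyC d p q : nearby d p q = nearby d q p.
Proof. by rewrite /nearby /= distrC [X in _ && (X < _)]distrC. Qed.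

Lemma apartC d p q : apart d p q = apart d q p.
Proof. by rewrite /apart /= distrC [X in _ || (_ <= X)]distrC. Qed.

Lemma quadrant_lt4 g : (quadrant g < 4)%N.
Proof. by rewrite /quadrant; do 3?case: ifP. Qed.

Lemma turn_mod i j : (i < 4)%N -> (j < 4)%N ->
  exists k : int, turn i j = j%:Z - i%:Z + 4 * k.
Proof.
by case: i => [|[|[|[|//]]]] _; case: j => [|[|[|[|//]]]] _;
  solve [by exists 0 | by exists 1 | by exists (-1)].
Qed.

Lemma quadrant_opp p q d : 0 < d -> apart d p q ->
  quadrant (q - p) = ((quadrant (p - q)%R).+2 %% 4)%N.
Proof.
case: p q => [p1 p2] [q1 q2] d0 /= /orP h; rewrite /quadrant /=.
have {h} : (p1 - q1 != 0) || (p2 - q2 != 0).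
  rewrite -negb_and; apply/negP => /andP[/eqP e1 /eqP e2].
  by move: h; rewrite e1 e2 normr0 => -[]; lra.
move=> h.
rewrite -[q1 - p1]opprB -[q2 - p2]opprB !oppr_gt0 !oppr_ge0 !oppr_lt0 !oppr_le0.
by case: (ltrgtP (p1 - q1) 0) h => _; case: (ltrgtP (p2 - q2) 0).
Qed.

Lemma quadrant_sign g :
  match quadrant g with
  | 0%N => 0 < g.1 /\ 0 <= g.2
  | 1%N => g.1 <= 0 /\ 0 < g.2
  | 2%N => g.1 < 0 /\ g.2 <= 0
  | _ => 0 <= g.1 /\ g.2 <= 0
  end.
Proof.
by rewrite /quadrant; case: (ltrgtP 0 g.1) => ?; case: (ltrgtP 0 g.2) => ? /=;
  split; lra.
Qed.

(** In the maximum norm, a move into the opposite quadrant is at least as long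
    as the vector. *)
Lemma nearby_not_opposite g h d : `|g.1 - h.1| < d -> `|g.2 - h.2| < d ->
  (d <= `|g.1|) || (d <= `|g.2|) -> quadrant h != ((quadrant g).+2 %% 4)%N.
Proof.
move=> /ltr_normlP[a1 a2] /ltr_normlP[b1 b2] far_g; apply/eqP => hg.
have {far_g} : d <= g.1 \/ d <= - g.1 \/ d <= g.2 \/ d <= - g.2.
  by move: far_g; rewrite !ler_normr => /orP[]/orP[]; auto.
have := quadrant_sign g; have := quadrant_sign h; rewrite {}hg.
by case: (quadrant g) (quadrant_lt4 g) => [|[|[|[|?]]]] //= _; lra.
Qed.

Lemma turn_opp i j : (i < 4)%N -> (j < 4)%N ->
  turn (i.+2 %% 4) (j.+2 %% 4) = turn i j.
Proof. by case: i => [|[|[|[|]]]] //; case: j => [|[|[|[|]]]]. Qed.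

(** Pairwise non-opposite quadrants lie among two adjacent ones, where turns
    add up. *)
Lemma turn_square i j k l : (i < 4)%N -> (j < 4)%N -> (k < 4)%N -> (l < 4)%N ->
  j != (i.+2 %% 4)%N -> k != (i.+2 %% 4)%N -> l != (i.+2 %% 4)%N ->
  l != (j.+2 %% 4)%N -> l != (k.+2 %% 4)%N -> k != (j.+2 %% 4)%N ->
  turn i j + turn j l = turn i k + turn k l.
Proof.
by case: i => [|[|[|[|]]]] //; case: j => [|[|[|[|]]]] //;
  case: k => [|[|[|[|]]]] //; case: l => [|[|[|[|]]]].
Qed.


Lemma turn_cell d p p' q q' : 0 < d -> nearby d p p' -> nearby d q q' ->
  apart (d + d) p q -> apart (d + d) p q' -> apart (d + d) p' q -> apart (d + d) p' q' ->
  turn (quadrant (p - q)) (quadrant (p' - q)) +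
    turn (quadrant (q - p')) (quadrant (q' - p')) =
  turn (quadrant (q - p)) (quadrant (q' - p)) +
    turn (quadrant (p - q')) (quadrant (p' - q')).
Proof.
move=> d0 pp qq f00 f01 f10 f11.
have dd0 : 0 < d + d by rewrite addr_gt0.
rewrite (quadrant_opp dd0 f00) (quadrant_opp dd0 f01) (quadrant_opp dd0 f10).
rewrite (quadrant_opp dd0 f11) !turn_opp ?quadrant_lt4//.
apply: turn_square; rewrite ?quadrant_lt4//.
all: move: pp qq f00 f01 f10 f11; case: p p' q q' => [p1 p2] [r1 r2] [q1 q2] [s1 s2].
all: rewrite /nearby /apart /= => /andP[/ltr_normlP[a1 a2] /ltr_normlP[b1 b2]].
all: move=> /andP[/ltr_normlP[c1 c2] /ltr_normlP[e1 e2]] f00 f01 f10 f11.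
all: apply: (@nearby_not_opposite _ _ (d + d)) => //=.
all: apply/ltr_normlP; split; lra.
Qed.

Lemma turn_strip d p p' r t : 0 < d -> nearby d p p' -> path (nearby d) r t ->
  {in r :: t, forall q, apart (d + d) p q && apart (d + d) p' q} ->
  turn (quadrant (p - r)) (quadrant (p' - r)) + winding p' r t =
  winding p r t + turn (quadrant (p - last r t)) (quadrant (p' - last r t)).
Proof.
move=> d0 pp; elim: t r => [|r' t IH] r /=; first by rewrite addr0 add0r.
move=> /andP[rr rt] F.
have /andP[f1 f2] : apart (d + d) p r && apart (d + d) p' r.
  by apply: F; rewrite mem_head.
have /andP[f3 f4] : apart (d + d) p r' && apart (d + d) p' r'.
  by apply: F; rewrite !inE eqxx orbT.
rewrite addrA (turn_cell d0 pp rr)// -addrA IH ?addrA// => q qt.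
by apply: F; rewrite inE qt orbT.
Qed.

(** The winding number around the boundary of a rectangle is zero, because it
    is the sum over small squares, for each of which it is zero.  Opposite
    vectors turn alike, so that the sides are counted from either edge. *)
Lemma winding_rectangle d p s r t : 0 < d ->
  path (nearby d) p s -> path (nearby d) r t ->
  {in p :: s & r :: t, forall u v, apart (d + d) u v} ->
  winding r p s + winding (last p s) r t =
  winding p r t + winding (last r t) p s.
Proof.
move=> d0 ps rt; elim: s p ps => [|p' s IH] p /=; first by rewrite addr0 add0r.
move=> /andP[pp ps] F; rewrite -addrA IH//; last first.
  by move=> u v us vt; apply: F => //; rewrite inE us orbT.
rewrite addrA (turn_strip d0 pp rt); first by rewrite addrA.
by move=> q qt; rewrite !F// ?inE ?eqxx ?orbT.
Qed.

Lemma winding_mod u p s : exists k : int,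
  winding u p s = (quadrant (last p s - u))%:Z - (quadrant (p - u))%:Z + 4 * k.
Proof.
elim: s p => [|q s IH] p /=; first by exists 0; rewrite subrr mulr0.
have [k ->] := IH q.
have [l ->] := turn_mod (quadrant_lt4 (p - u)) (quadrant_lt4 (q - u)).
by exists (k + l); ring.
Qed.

End Winding.

(** * Chains in connected sets *)

Section Continua.
Variable R : realType.
Local Open Scope classical_set_scope.
Local Open Scope ring_scope.
Implicit Types (p q : R * R) (A B C : set (R * R)).

Lemma connected_locally_constant (T : topologicalType) (A P : set T) x :
  connected A -> A x -> P x ->
  (forall y, A y -> \forall z \near y, A z -> P y <-> P z) -> A `<=` P.
Proof.
move=> cA Ax Px loc y Ay; apply: contrapT => nPy.
move/connectedP: cA => /(_ (fun b => if b then A `&` P else A `\` P)); apply.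
split; first by case; [exists x|exists y].
  rewrite setUC; apply/seteqP; split=> [z Az|z [[]|[]]//].
  by have [] := pselect (P z); [left|right].
split; rewrite -subset0 => z /=.
  move=> [clz [Az Pz]]; have [w [[Aw nPw] zw]] := clz _ (loc z Az).
  by apply: nPw; apply/(zw Aw).
move=> [[Az nPz] clz]; have [w [[Aw Pw] zw]] := clz _ (loc z Az).
by apply: nPz; apply/(zw Aw).
Qed.

Lemma near_nearby d p : 0 < d -> \forall q \near p, nearby d p q.
Proof.
move=> d0; near=> q; have : ball p d q by near: q; exact: nbhsx_ballx.
by rewrite -ball_normE /ball_ /= prod_normE /= gt_max.
Unshelve. all: by end_near. Qed.

(** The points reachable by such chains form a set that is open and closed in
    A. *)
Lemma connected_chain A p q d : 0 < d -> connected A -> A p -> A q ->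
  exists s, [/\ path (nearby d) p s, last p s = q & {in p :: s, forall r, A r}].
Proof.
move=> d0 cA Ap Aq.
pose P := [set q | exists s, [/\ path (nearby d) p s, last p s = q
  & {in p :: s, forall r, A r}]].
have ext y z : P y -> A z -> nearby d y z -> P z.
  move=> [s [ps <- sA]] Az yz; exists (rcons s z); split.
  - by rewrite rcons_path ps.
  - by rewrite last_rcons.
  - by move=> r; rewrite -rcons_cons mem_rcons inE => /predU1P[->//|/sA].
apply: (connected_locally_constant (P := P) cA Ap) => //.
  by exists [::]; split => // r; rewrite inE => /eqP ->.
move=> y Ay; near=> z => Az.
have yz : nearby d y z by near: z; exact: near_nearby.
by split=> H; apply: ext H _ _ => //; rewrite nearbyC.
Unshelve. all: by end_near. Qed.

Lemma compact_disjoint_apart A B : compact A -> compact B -> A `&` B = set0 ->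
  exists2 d : R, 0 < d & forall p q, A p -> B q -> apart d p q.
Proof.
move=> cA cB AB0.
have [AB|/set0P AB0'] := eqVneq (A `*` B) set0.
  exists 1 => // p q Ap Bq; have : (A `*` B) (p, q) by [].
  by rewrite AB.
pose f (z : (R * R) * (R * R)) : R := `|z.1 - z.2|.
have cf : continuous f.
  by move=> z; apply: cvg_norm; apply: cvgB; [exact: cvg_fst|exact: cvg_snd].
have [|[p0 q0] /set_mem[/= Ap0 Bq0] fmin] :=
    @compact_EVT_min _ R f _ AB0' (compact_setX cA cB).
  exact: continuous_subspaceT.
 exists (f (p0, q0)).
  rewrite /f normr_gt0 subr_eq0; apply/eqP => /= e.
  have : (A `&` B) p0 by split=> //; rewrite e.
  by rewrite AB0.
move=> p q Ap Bq; have := fmin (p, q); rewrite inE => /(_ (conj Ap Bq)).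
by rewrite {2}/f prod_normE /= le_max.
Qed.

Lemma common_bound (I : finType) (P : I -> R -> Prop) :
  (forall i, exists2 d, 0 < d & P i d) ->
  (forall i d d', 0 < d' -> d' <= d -> P i d -> P i d') ->
  exists2 d : R, 0 < d & forall i, P i d.
Proof.
move=> H mono.
have {}H i : exists d, 0 < d /\ P i d by have [d] := H i; exists d.
have [f fP] := choice H.
exists (\big[Num.min/1]_i f i) => [|i].
  by elim/big_ind: _ => // [x y x0 y0|i _]; [rewrite lt_min x0|case: (fP i)].
have [fi Pi] := fP i; apply: mono Pi; last exact: bigmin_le_cond.
by elim/big_ind: _ => // [x y x0 y0|j _]; [rewrite lt_min x0|case: (fP j)].
Qed.

End Continua.

(** * Drawings of K5 and K33 by continua *)

Section IndependentEdges.
Variables (R : realType) (N : nat) (e : rel nat).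
Variables (P : nat -> R * R) (E : nat -> nat -> set (R * R)).
Local Open Scope classical_set_scope.
Local Open Scope ring_scope.

Definition edge_at (i j : nat) := [&& (i < j)%N, (j < N)%N & e i j].

Definition independent_edges (i j k l : nat) :=
  [&& edge_at i j, edge_at k l, i != k, i != l, j != k & j != l].

Hypothesis E_compact : forall i j, edge_at i j -> compact (E i j).
Hypothesis E_connected : forall i j, edge_at i j -> connected (E i j).
Hypothesis E_source : forall i j, edge_at i j -> E i j (P i).
Hypothesis E_target : forall i j, edge_at i j -> E i j (P j).
Hypothesis E_disjoint : forall i j k l, independent_edges i j k l ->
  E i j `&` E k l = set0.

Lemma independent_edges_apart : exists2 d : R, 0 < d &
  forall i j k l, independent_edges i j k l ->
    forall p q, E i j p -> E k l q -> apart d p q.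
Proof.
pose Q (x : 'I_N * 'I_N * ('I_N * 'I_N)) (d : R) :=
  let i : nat := x.1.1 in let j : nat := x.1.2 in
  let k : nat := x.2.1 in let l : nat := x.2.2 in
  independent_edges i j k l ->
  forall p q, E i j p -> E k l q -> apart d p q.
have [x|x d d' d'0 d'd|d d0 Hd] := @common_bound R _ Q.
- have [ind|nind] := boolP (independent_edges x.1.1 x.1.2 x.2.1 x.2.2).
    have /and3P[e1 e2 _] := ind.
    have [d d0 H] := compact_disjoint_apart (E_compact e1) (E_compact e2)
      (E_disjoint ind).
    by by exists d => //; rewrite /Q /= => _.
  by exists 1 => //; rewrite /Q /= (negPf nind).
- rewrite /Q /= => Qd ind p q Ep Eq; have := Qd ind p q Ep Eq; rewrite /apart /=.
  by case/orP => h; rewrite (le_trans d'd h) ?orbT.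
exists d => // i j k l ind; have /and3P[/and3P[ij jN _] /and3P[kl lN _] _] := ind.
have iN := ltn_trans ij jN; have kN := ltn_trans kl lN.
exact: (Hd (Ordinal iN, Ordinal jN, (Ordinal kN, Ordinal lN)) ind).
Qed.

(** The integer n u v v' lifts the quarter turns around u along the edge vv':
    four times n u v v' is the difference between these turns and those computed
    from the positions of the end vertices.  For u < v the direction
    from v to u is recorded as that from u to v plus two quarter turns, and this
    normalization leaves the constant 1 exactly when the two edges interleave,
    that is, when they would cross with all vertices placed in order on a
    circle. *)
Lemma crossing_relation : exists n : nat -> nat -> nat -> int,
  forall u u' v v', independent_edges u u' v v' -> (u < v)%N ->
    n v u u' + n u' v v' =
    n u v v' + n v' u u' + ((v < u')%N && (u' < v')%N)%:Z.
Proof.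
have [d0 d00 far0] := independent_edges_apart.
(* Two moves of length less than d stay below the distance d0. *)
pose d := d0 / 2; have d_gt0 : 0 < d by rewrite divr_gt0.
have dE : d0 = d + d by rewrite /d; field.
have /choice[S SP] : forall ij : nat * nat, exists s : seq (R * R),
    edge_at ij.1 ij.2 -> [/\ path (nearby d) (P ij.1) s,
      last (P ij.1) s = P ij.2
      & {in P ij.1 :: s, forall r, E ij.1 ij.2 r}].
  move=> [i j] /=; have [ij|nij] := boolP (edge_at i j); last by exists [::].
  have [s sP] := connected_chain d_gt0 (E_connected ij) (E_source ij) (E_target ij).
  by exists s.
pose b x y : int := (quadrant (P y - P x))%:Z.
pose T x y : int := if (x < y)%N then b x y else b y x + 2.
have Tb x y : apart d0 (P x) (P y) -> exists k : int, b x y = T x y + 4 * k.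
  move=> xy; rewrite /T; case: ltnP => _; first by exists 0; lia.
  rewrite /b (quadrant_opp d00 xy).
  have := quadrant_lt4 (P x - P y); case: (quadrant _) => [|[|[|[|//]]]] _ /=;
    solve [by exists 0 | by exists (-1)].
have /choice[n nP] : forall x : nat * nat * nat, exists k : int,
    edge_at x.1.2 x.2 -> apart d0 (P x.1.1) (P x.1.2) ->
    apart d0 (P x.1.1) (P x.2) ->
    winding (P x.1.1) (P x.1.2) (S (x.1.2, x.2)) =
    T x.1.1 x.2 - T x.1.1 x.1.2 + 4 * k.
  move=> [[u v] v'] /=.
  have [vv|nvv] := boolP (edge_at v v'); last by exists 0.
  have [uv|nuv] := boolP (apart d0 (P u) (P v)); last by exists 0.
  have [uv'|nuv] := boolP (apart d0 (P u) (P v')); last by exists 0.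
  have [k ->] := winding_mod (P u) (P v) (S (v, v')).
  have [_ /= -> _] := SP (v, v') vv.
  have [k1] := Tb u v uv; have [k2] := Tb u v' uv'; rewrite /b => -> ->.
  by exists (k + k2 - k1) => _ _ _; ring.
exists (fun x y z => n (x, y, z)) => u u' v v' ind uv.
have /and3P[uu vv /and4P[n1 n2 n3 n4]] := ind.
have [/= pu lu Su] := SP (u, u') uu; have [/= pv lv Sv] := SP (v, v') vv.
have farE := far0 _ _ _ _ ind.
have SS : {in P u :: S (u, u') & P v :: S (v, v'), forall x y, apart (d + d) x y}.
  by move=> x y /Su Ex /Sv Ey; rewrite -dE farE.
have := winding_rectangle d_gt0 pu pv SS; rewrite lu lv.
have [Eu Eu'] := (E_source uu, E_target uu).
have [Ev Ev'] := (E_source vv, E_target vv).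
rewrite (nP (v, u, u'))//=; try by rewrite apartC farE.
rewrite (nP (u', v, v'))//=; try by rewrite farE.
rewrite (nP (u, v, v'))//=; try by rewrite farE.
rewrite (nP (v', u, u'))//=; try by rewrite apartC farE.
have /and3P[_ _ /= _] := uu; have /andP[v_lt _] := vv.
have uv' := ltn_trans uv v_lt.
rewrite /T uv uv' [(v < u)%N]ltnNge (ltnW uv) [(v' < u)%N]ltnNge (ltnW uv') /=.
case: (ltngtP v u') n3 => [||->]; rewrite ?eqxx// => c1 _;
  case: (ltngtP u' v') n4 => [||->]; rewrite ?eqxx// => c2 _ /=; lia.
Qed.

End IndependentEdges.

(** In the sum over the 15 pairs of independent edges every integer occurs
    twice, and 5 pairs interleave. *)
Lemma no_K5_continua (R : realType) (P : nat -> R * R)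
    (E : nat -> nat -> set (R * R)) (e := fun _ _ : nat => true) :
  (forall i j, edge_at 5 e i j ->
    [/\ compact (E i j), connected (E i j), E i j (P i) & E i j (P j)]) ->
  (forall i j k l, independent_edges 5 e i j k l ->
    (E i j `&` E k l = set0)%classic) -> False.
Proof.
move=> HE Hd.
have [|||||n H] := @crossing_relation R 5 e P E; try by move=> i j /HE[].
  exact: Hd.
have := H 1 2 3 4 isT isT.
have := H 1 3 2 4 isT isT.
have := H 1 4 2 3 isT isT.
have := H 0 2 3 4 isT isT.
have := H 0 3 2 4 isT isT.
have := H 0 4 2 3 isT isT.
have := H 0 1 3 4 isT isT.
have := H 0 3 1 4 isT isT.
have := H 0 4 1 3 isT isT.
have := H 0 1 2 4 isT isT.
have := H 0 2 1 4 isT isT.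
have := H 0 4 1 2 isT isT.
have := H 0 1 2 3 isT isT.
have := H 0 2 1 3 isT isT.
have := H 0 3 1 2 isT isT.
rewrite /=; lia.
Qed.

(** With the two sides alternating on the circle, only the three long diagonals
    of the hexagon interleave. *)
Lemma no_K33_continua (R : realType) (P : nat -> R * R)
    (E : nat -> nat -> set (R * R)) (e := fun i j : nat => odd (i + j)) :
  (forall i j, edge_at 6 e i j ->
    [/\ compact (E i j), connected (E i j), E i j (P i) & E i j (P j)]) ->
  (forall i j k l, independent_edges 6 e i j k l ->
    (E i j `&` E k l = set0)%classic) -> False.
Proof.
move=> HE Hd.
have [|||||n H] := @crossing_relation R 6 e P E; try by move=> i j /HE[].
  exact: Hd.
have := H 0 1 2 3 isT isT.
have := H 0 1 2 5 isT isT.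
have := H 0 1 3 4 isT isT.
have := H 0 1 4 5 isT isT.
have := H 0 3 1 2 isT isT.
have := H 0 3 1 4 isT isT.
have := H 0 3 2 5 isT isT.
have := H 0 3 4 5 isT isT.
have := H 0 5 1 2 isT isT.
have := H 0 5 1 4 isT isT.
have := H 0 5 2 3 isT isT.
have := H 0 5 3 4 isT isT.
have := H 1 2 3 4 isT isT.
have := H 1 2 4 5 isT isT.
have := H 1 4 2 3 isT isT.
have := H 1 4 2 5 isT isT.
have := H 2 3 4 5 isT isT.
have := H 2 5 3 4 isT isT.
rewrite /=; lia.
Qed.

(** * Reaching a boundary point of an open set *)

Section Arms.
Variable R : realType.
Local Open Scope classical_set_scope.
Local Open Scope ring_scope.
Implicit Types (p q z : R * R) (F U C : set (R * R)).

Definition segment p q : set (R * R) :=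
  (fun t : R => (p.1 + t * (q.1 - p.1), p.2 + t * (q.2 - p.2))) @` `[0, 1].

Lemma segment_source p q : segment p q p.
Proof.
exists 0; first by rewrite /= in_itv /= lexx ler01.
by rewrite !mul0r !addr0; case: p.
Qed.

Lemma segment_target p q : segment p q q.
Proof.
exists 1; first by rewrite /= in_itv /= lexx ler01.
by rewrite !mul1r; case: p q => [p1 p2] [q1 q2] /=; congr pair; ring.
Qed.

Lemma segment_map_continuous p q :
  continuous (fun t : R => (p.1 + t * (q.1 - p.1), p.2 + t * (q.2 - p.2))).
Proof.
have c (a b : R) : continuous (fun t : R => a + t * b).
  move=> t; apply: cvgD; first exact: cvg_cst.
  by apply: continuousM; [exact: cvg_id|exact: cvg_cst].
by move=> t; exact: (cvg_pair (c _ _ t) (c _ _ t)).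
Qed.

Lemma compact_plane_segment p q : compact (segment p q).
Proof.
apply: continuous_compact; last exact: segment_compact.
exact/continuous_subspaceT/segment_map_continuous.
Qed.

Lemma connected_plane_segment p q : connected (segment p q).
Proof.
apply: connected_continuous_connected; first exact: segment_connected.
exact/continuous_subspaceT/segment_map_continuous.
Qed.

Lemma segment_nearby d p q r : nearby d p q -> segment p q r -> nearby d p r.
Proof.
case: p q => [p1 p2] [q1 q2] /andP[/= h1 h2] [t]; rewrite /= in_itv /=.
move=> /andP[t0 t1] <-; rewrite /nearby /=.
have sub a b : `|a - b| < d -> `|a - (a + t * (b - a))| < d.
  move=> ab; rewrite opprD addNKr normrN normrM (ger0_norm t0) distrC.
  by rewrite (le_lt_trans _ ab)// ler_piMl.
by rewrite !sub.
Qed.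

(** The points of F that a continuum in U joins to z form an open and closed
    part of F; a last segment leads to p. *)
Lemma open_arm F U z p : connected F -> F `<=` U -> open U -> F z ->
  closure F p -> U p ->
  exists C, [/\ compact C, connected C, C `<=` U, C z & C p].
Proof.
move=> cF FU oU Fz clp Up.
pose P := [set q | exists C, [/\ compact C, connected C, C `<=` U, C z & C q]].
have ext q r : P q -> segment q r `<=` U -> P r.
  move=> [C [coC conC CU Cz Cq]] qrU; exists (C `|` segment q r); split.
  - by apply: compactU => //; exact: compact_plane_segment.
  - apply: connectedU => //; last exact: connected_plane_segment.
    by exists q; split=> //; exact: segment_source.
  - by move=> x [/CU|/qrU].
  - by left.
  - by right; exact: segment_target.
have room q : U q -> exists2 d : R, 0 < d & forall r, nearby d q r -> U r.
  move=> Uq; have : nbhs q U by exact: open_nbhs_nbhs.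
  move=> /nbhs_ballP[d /= d0 dU]; exists d => // r qr; apply: dU.
  by rewrite -ball_normE /ball_ /= prod_normE /= gt_max.
have swap q r : segment q r = segment r q.
  have sub a b : segment a b `<=` segment b a.
    case: a b => [a1 a2] [b1 b2] x [t /=]; rewrite in_itv /= => /andP[t0 t1] <-.
    exists (1 - t); first by rewrite /= in_itv /=; apply/andP; split; lra.
    by congr pair; rewrite /=; ring.
  by apply/seteqP; split; exact: sub.
have FP : F `<=` P.
  apply: (connected_locally_constant cF Fz).
    exists (segment z z); split; [exact: compact_plane_segment
      |exact: connected_plane_segment| |exact: segment_source
      |exact: segment_target].
    have [d d0 dU] := room z (FU _ Fz) => x zx; apply: dU.
    by apply: segment_nearby zx; rewrite /nearby /= !subrr normr0 d0.
  move=> y Fy; have [d d0 dU] := room y (FU _ Fy).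
  near=> x => Fx; have yx : nearby d y x by near: x; exact: near_nearby.
  have sU : segment y x `<=` U by move=> r /(segment_nearby yx)/dU.
  by split=> H; apply: ext H _ => //; rewrite swap.
have [d d0 dU] := room p Up.
have [y [Fy py]] := clp _ (near_nearby p d0).
apply: ext (FP _ Fy) _ => r; rewrite swap => /(segment_nearby py); exact: dU.
Unshelve. all: by end_near. Qed.

End Arms.

(** * Drawings of connected subgraphs *)

Section OuterplanarDrawing.
Variables (R : realType) (G : sgraph).
Variables (pos : G -> R * R) (arc : G -> G -> R -> R * R) (F : set (R * R)).
Local Open Scope classical_set_scope.
Local Open Scope ring_scope.
Hypothesis emb : planar_embedding pos arc.
Hypothesis outF : outer_face (drawing pos arc) F.
Hypothesis F_boundary : forall v, boundary F (pos v).
Implicit Types (K : {set G}).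

Definition inner_edges K : pred (G * G) :=
  [pred e | [&& e.1 \in K, e.2 \in K & adj e.1 e.2]].

Definition drawn K : set (R * R) :=
  \bigcup_(v in [set` K]) [set pos v] `|`
  \bigcup_(e in [set` inner_edges K]) (arc e.1 e.2 @` `[0, 1]).

Lemma drawn_pos K v : v \in K -> drawn K (pos v).
Proof. by move=> vK; left; exists v. Qed.

Lemma drawn_sub K K' : K \subset K' -> drawn K `<=` drawn K'.
Proof.
move=> /fintype.subsetP KK x [[v vK ->]|[e /= /and3P[e1 e2 e12] xe]].
  by left; exists v => //; exact: KK.
by right; exists e => //=; apply/and3P; split; try apply: KK.
Qed.

Lemma arc_compact u v : adj u v -> compact (arc u v @` `[0, 1]).
Proof.
move=> uv; apply: continuous_compact; last exact: segment_compact.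
exact: arc_continuous emb _ _ uv.
Qed.

Lemma arc_connected u v : adj u v -> connected (arc u v @` `[0, 1]).
Proof.
move=> uv; apply: connected_continuous_connected; first exact: segment_connected.
exact: arc_continuous emb _ _ uv.
Qed.

Lemma drawn_compact K : compact (drawn K).
Proof.
apply: compactU; rewrite bigcup_pred; apply: bigsetU_compact.
  by move=> v _; exact: compact_set1.
by move=> e /and3P[_ _]; exact: arc_compact.
Qed.

Lemma drawn_connected K : connected_in K -> connected (drawn K).
Proof.
move=> cK; have [->|/set0Pn[x xK]] := eqVneq K finset.set0.
  rewrite (_ : drawn _ = set0); first exact: connected0.
  by rewrite -subset0 => y [[v]|[e /= /and3P[]]]; rewrite /= inE.
pose C := connected_component (drawn K) (pos x).
suff -> : drawn K = C by exact: component_connected.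
rewrite eqEsubset; split; last exact: connected_component_sub.
have arcC u v : u \in K -> v \in K -> adj u v -> C (pos u) ->
    arc u v @` `[0, 1] `<=` C.
  move=> uK vK uv Cu y uvy; apply: connected_component_trans Cu _.
  exists (arc u v @` `[0, 1]) => //; split; last exact: arc_connected.
    exists 0; last exact: arc_source emb _ _ uv.
    by rewrite /= in_itv /= lexx ler01.
  by move=> z uvz; right; exists (u, v) => //=; apply/and3P.
have posC v : v \in K -> C (pos v).
  move=> vK; have /connectP[p] := cK x v xK vK.
  have Cx : C (pos x) by apply: connected_component_refl; exact: drawn_pos.
  elim: p {1 2 3 4}x xK Cx => [|y p IH] u uK Cu /=; first by move=> _ ->.
  move=> /andP[/and3P[_ yK uy] yp]; apply: IH yp => //.
  apply: (arcC u y) => //; exists 1; last exact: arc_target emb _ _ uy.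
  by rewrite /= in_itv /= lexx ler01.
move=> y [[v /= vK ->]|[[u v] /= /and3P[uK vK uv]]]; first exact: posC.
by apply: arcC => //; exact: posC.
Qed.

Lemma arc_cases u v p : adj u v -> (arc u v @` `[0, 1]) p ->
  [\/ p = pos u, p = pos v | (arc u v @` `]0, 1[) p].
Proof.
move=> uv [t /=]; rewrite in_itv /= => /andP[t0 t1] <-.
have [->|t0'] := eqVneq t 0; first by constructor 1; exact: arc_source emb _ _ uv.
have [->|t1'] := eqVneq t 1; first by constructor 2; exact: arc_target emb _ _ uv.
constructor 3; exists t => //=.
by rewrite in_itv /= lt_neqAle eq_sym t0' t0 /= lt_neqAle t1' t1.
Qed.

Lemma drawn_disjoint K K' : [disjoint K & K']%B -> drawn K `&` drawn K' = set0.
Proof.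
move=> KK; have neq u v : u \in K -> v \in K' -> u <> v.
  by move=> uK vK uv; move: vK; rewrite -uv (disjointFr KK uK).
have posN u v : u \in K -> v \in K' -> pos u <> pos v.
  by move=> uK vK /(pos_inj emb); exact: neq.
have arcN u v w : adj u v -> (arc u v @` `]0, 1[) (pos w) -> False.
  by move=> uv; exact: arc_avoids_vertices emb _ _ _ uv.
rewrite -subset0 => p [].
case=> [[u /= uK ->]|[[u v] /= /and3P[/= uK vK uv] uvp]].
  case=> [[w /= wK /posN]|[[w x] /= /and3P[/= wK xK wx]]]; first by move/(_ uK).
  move=> /(arc_cases wx)[/posN|/posN|/arcN]; [exact|exact|exact].
case=> [[w /= wK pE]|[[w x] /= /and3P[/= wK xK wx]]].
  move: uvp; rewrite pE => /(arc_cases uv)[/esym/posN|/esym/posN|/arcN]; [exact|exact|exact].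
move: uvp => /(arc_cases uv)[->|->|uvp] /(arc_cases wx)[].
- exact: posN.
- exact: posN.
- exact: arcN.
- exact: posN.
- exact: posN.
- exact: arcN.
- by move=> pE; move: uvp; rewrite pE => /arcN; exact.
- by move=> pE; move: uvp; rewrite pE => /arcN; exact.
move=> wxp; have := arc_disjoint emb uv wx; rewrite -subset0 => H.
apply: (H _ p); last by [].
move=> e; apply: (neq u u) => //.
have : u \in [set w; x]%SET by rewrite -e !inE eqxx.
by case/finset.set2P => ->.
Qed.

(** The face is connected and lies in the open complement of the drawing of all
    vertices other than v, which contains the position of v. *)
Lemma face_arm z v : F z -> exists C, [/\ compact C, connected C, C z, C (pos v)
  & C `&` drawn (~: [set v]%SET) = set0].
Proof.
move=> Fz; have [[x _ FE] _] := outF.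
have conF : connected F by rewrite FE; exact: component_connected.
have Fdraw : F `<=` ~` drawing pos arc by rewrite FE; exact: connected_component_sub.
pose U := ~` drawn (~: [set v]%SET).
have FU : F `<=` U.
  move=> y /Fdraw nD; apply: contra_not nD.
  move=> [[w _ ->]|[e /= /and3P[_ _ e12] ye]]; first by left; exists w.
  by right; exists e.
have oU : open U.
  apply: closed_openC; apply: compact_closed; last exact: drawn_compact.
  exact: norm_hausdorff.
have Uv : U (pos v).
  move=> vU; have := @drawn_disjoint [set v]%SET (~: [set v])%SET.
  rewrite -subset0 finset.disjoints_subset finset.setCK fintype.subxx => /(_ isT).
  by apply; split; [apply: drawn_pos; rewrite inE|exact: vU].
have [clv _] := F_boundary v.
have [C [coC conC CU Cz Cv]] := open_arm conF FU oU Fz clv Uv.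
by exists C; split=> //; rewrite -subset0 => y [/CU].
Qed.


End OuterplanarDrawing.

Section Apex.
Variables (R : realType) (G : sgraph).
Variables (pos : G -> R * R) (arc : G -> G -> R -> R * R) (F : set (R * R)).
Local Open Scope classical_set_scope.
Local Open Scope ring_scope.
Hypothesis emb : planar_embedding pos arc.
Hypothesis outF : outer_face (drawing pos arc) F.
Hypothesis F_boundary : forall v, boundary F (pos v).

(** The index 4 stands for the point of the outer face; all other indices stand
    for branch sets B i with a chosen vertex rep i.  An edge between branch sets
    is drawn as the subgraph that they span together. *)
Lemma apex_continua N (e : rel nat) (B : nat -> {set G}) (rep : nat -> G) :
  (forall i, (i < N)%N -> i != 4%N -> rep i \in B i) ->
  (forall i j, edge_at N e i j -> i != 4%N -> j != 4%N ->
     connected_in (B i :|: B j)) ->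
  (forall i j, (i < N)%N -> (j < N)%N -> i != 4%N -> j != 4%N -> i != j ->
     [disjoint B i & B j]%B) ->
  exists P : nat -> R * R, exists E : nat -> nat -> set (R * R),
    (forall i j, edge_at N e i j ->
      [/\ compact (E i j), connected (E i j), E i j (P i) & E i j (P j)]) /\
    (forall i j k l, independent_edges N e i j k l ->
      E i j `&` E k l = set0).
Proof.
move=> repB Bconn Bdisj.
have [z Fz] : F !=set0.
  have [[x nDx FE] _] := outF; exists x; rewrite FE.
  exact: connected_component_refl.
have /choice[C CP] := fun v => face_arm emb outF F_boundary v Fz.
pose P i := if i == 4%N then z else pos (rep i).
pose E i j := if i == 4%N then C (rep j) else if j == 4%N then C (rep i)
  else drawn pos arc (B i :|: B j).
exists P, E; split=> [i j ij|i j k l].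
  have /and3P[i_lt jN eij] := ij; have iN := ltn_trans i_lt jN.
  rewrite /E /P; case: (eqVneq i 4%N) i_lt => [->|i4] i_lt.
    by rewrite gtn_eqF//; have [? ? ? ? _] := CP (rep j).
  case: (eqVneq j 4%N) => [_|j4]; first by have [? ? ? ? _] := CP (rep i).
  split; [exact: (drawn_compact emb)|apply: (drawn_connected emb); exact: Bconn| |];
    by apply: drawn_pos; rewrite finset.inE repB ?orbT.
move=> /and3P[/and3P[ij jN eij] /and3P[kl lN ekl] /and4P[ik il jk jl]].
have iN := ltn_trans ij jN; have kN := ltn_trans kl lN.
have arm a x y : (a < N)%N -> (x < N)%N -> (y < N)%N -> a != 4%N ->
    x != 4%N -> y != 4%N -> a != x -> a != y ->
    C (rep a) `&` drawn pos arc (B x :|: B y) = set0.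
  move=> aN xN yN a4 x4 y4 ax ay; rewrite -subset0 => p [Cp].
  have [_ _ _ _ Cd] := CP (rep a).
  have sub : B x :|: B y \subset ~: [set rep a]%SET.
    apply/fintype.subsetP => w; rewrite !finset.inE.
    apply: contraTneq => ->; have ra := repB a aN a4.
    by rewrite negb_or (disjointFr (Bdisj _ _ aN xN a4 x4 ax) ra)
      (disjointFr (Bdisj _ _ aN yN a4 y4 ay) ra).
  by move=> /(drawn_sub sub) Dp; rewrite -Cd.
have sepB x y u v : (x < N)%N -> (y < N)%N -> (u < N)%N -> (v < N)%N ->
    x != 4%N -> y != 4%N -> u != 4%N -> v != 4%N ->
    x != u -> x != v -> y != u -> y != v ->
    drawn pos arc (B x :|: B y) `&` drawn pos arc (B u :|: B v) = set0.
  move=> *; apply: (drawn_disjoint emb).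
  rewrite finset.disjoints_subset finset.subUset -!finset.disjoints_subset.
  rewrite ![[disjoint _ & _ :|: _]%B]disjoint_sym !finset.disjoints_subset.
  by rewrite !finset.subUset -!finset.disjoints_subset !Bdisj// eq_sym.
rewrite /E; case: (eqVneq i 4%N) ij ik il => [->|i4] ij ik il.
  have j4 : j != 4%N by rewrite gtn_eqF.
  rewrite eq_sym (negPf ik) eq_sym (negPf il).
  by apply: arm => //; rewrite eq_sym.
case: (eqVneq j 4%N) jk jl => [->|j4] jk jl.
  rewrite eq_sym (negPf jk) eq_sym (negPf jl).
  by apply: arm => //; rewrite eq_sym.
case: (eqVneq k 4%N) kl => [k4|k4] kl.
  have l4 : l != 4%N by rewrite gtn_eqF// -k4.
  by rewrite setIC; apply: arm => //; rewrite eq_sym.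
case: (eqVneq l 4%N) => [l4|l4].
  by rewrite setIC; apply: arm => //; rewrite eq_sym.
exact: sepB.
Qed.

End Apex.

Section Excluded.
Variables (R : realType) (G : sgraph).
Hypothesis outG : outerplanar R G.

(** The vertices a, b and the point of the outer face are the even side of a
    K_{3,3}, the three branch sets are its odd side. *)
Lemma outerplanar_theta_free : theta_free G.
Proof.
move=> a b Q1 Q2 Q3 ab [c1 a1 b1 ta1 tb1] [c2 a2 b2 ta2 tb2] [c3 a3 b3 ta3 tb3].
move=> d12 d13 d23; have [pos [arc [emb [F outF Fb]]]] := outG.
have /touchesP[q1 q1Q _] := ta1; have /touchesP[q2 q2Q _] := ta2.
have /touchesP[q3 q3Q _] := ta3.
pose B i := nth finset.set0 [:: [set a]; Q1; [set b]; Q2; finset.set0; Q3]%SET i.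
pose rep i := nth a [:: a; q1; b; q2; a; q3] i.
pose e i j := odd (i + j).
have [|||P [E [HE Hd]]] := @apex_continua R G pos arc F emb outF Fb 6 e B rep.
- by do 6?[case=> [|]] => //=; rewrite ?inE.
- have ca Q : connected_in Q -> touches Q a -> connected_in (Q :|: [set a]).
    by move=> cQ tQ; rewrite finset.setUC; exact: connected_in_touch.
  have cb Q : connected_in Q -> touches Q b -> connected_in (Q :|: [set b]).
    by move=> cQ tQ; rewrite finset.setUC; exact: connected_in_touch.
  case=> [|[|[|[|[|[|?]]]]]]; case=> [|[|[|[|[|[|?]]]]]] ; move=> /and3P[ij jN eij] i4 j4;
   first [by case/negP: i4 | by case/negP: j4 | by case: (notF eij) | by move: ij jN; clear; lia
     | rewrite /B /=; solve [exact: connected_in_touch | exact: ca | exact: cb]].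
- have sd x (Q : {set G}) : x \notin Q -> [disjoint [set x]%SET & Q]%B.
    by rewrite disjoints1.
  have ds x (Q : {set G}) : x \notin Q -> [disjoint Q & [set x]%SET]%B.
    by rewrite disjoint_sym disjoints1.
  case=> [|[|[|[|[|[|?]]]]]]; case=> [|[|[|[|[|[|?]]]]]] // _ _ _ _ _;
   solve [done | exact: sd | exact: ds | by rewrite disjoint_sym
     | by apply: sd; rewrite inE | by apply: sd; rewrite inE eq_sym].
exact: no_K33_continua HE Hd.
Qed.

Lemma outerplanar_K4_free : K4_free G.
Proof.
move=> u v w Q uv vw uw cQ uQ vQ wQ tu tv tw.
have [pos [arc [emb [F outF Fb]]]] := outG.
have /touchesP[q qQ _] := tu.
pose B i := nth finset.set0 [:: [set u]; [set v]; [set w]; Q]%SET i.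
pose rep i := nth u [:: u; v; w; q] i.
pose e (i j : nat) := true.
have [|||P [E [HE Hd]]] := @apex_continua R G pos arc F emb outF Fb 5 e B rep.
- by do 5?[case=> [|]] => //=; rewrite ?inE.
- case=> [|[|[|[|[|?]]]]]; case=> [|[|[|[|[|?]]]]] ; move=> /and3P[ij jN eij] i4 j4;
   first [by case/negP: i4 | by case/negP: j4 | by move: ij jN; clear; lia
     | rewrite /B /=; solve [exact: connected_in_touch | exact: connected_in_adj]].
- have sd x (S : {set G}) : x \notin S -> [disjoint [set x]%SET & S]%B.
    by rewrite disjoints1.
  have ds x (S : {set G}) : x \notin S -> [disjoint S & [set x]%SET]%B.
    by rewrite disjoint_sym disjoints1.
  have nuv := adj_neq uv; have nvw := adj_neq vw; have nuw := adj_neq uw.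
  case=> [|[|[|[|[|?]]]]]; case=> [|[|[|[|[|?]]]]] //= _ _ _ _ _;
   solve [done | exact: sd | exact: ds | by apply: sd; rewrite inE
     | by apply: sd; rewrite inE eq_sym | by apply: ds; rewrite inE eq_sym].
exact: no_K5_continua HE Hd.
Qed.

End Excluded.

(** * The theorem *)

Lemma sublist_of_card (T : eqType) (A : set T) (n : nat) : (`I_n #<= A)%card ->
  exists s : seq T, [/\ uniq s, size s = n & forall x, x \in s -> A x].
Proof.
move=> /card_leP[f].
have mem_I (i : 'I_n) : (i : nat) \in `I_n by rewrite inE /= ltn_ord.
exists [seq val (f (SigSub (mem_I i))) | i <- enum 'I_n]; split.
- rewrite map_inj_uniq ?enum_uniq// => i j /val_inj/inj e.
  by apply: val_inj; have /(congr1 val) := e (mem_setT _) (mem_setT _).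
- by rewrite size_map size_enum_ord.
- by move=> x /mapP[i _ ->]; apply/set_mem/valP.
Qed.

Lemma connected_in_graph (G : sgraph) :
  connected_graph G -> connected_in [set: G]%SET.
Proof.
move=> cG u v _ _; rewrite (eq_connect (e' := @adj G)); first exact: cG.
by move=> x y; rewrite /adj_in /= !inE.
Qed.

Lemma conflict_free_at_card (G : sgraph) (C : eqType) (psi : G -> C) v :
  conflict_free_at psi v ->
  exists c, #|(psi @^-1: pred1 c :&: neigh v)%SET| = 1%N.
Proof.
move=> [u vu uniq_u]; exists (psi u); rewrite -(cards1 u); congr #|pred_of_set _|.
apply/setP => w; rewrite !inE; apply/andP/eqP => [[/eqP wu vw]|->].
  exact: uniq_u.
by rewrite eqxx.
Qed.

Theorem theorem3 (R : realType) (G : sgraph)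
    (G_connected : connected_graph G)
    (G_outerplanar : outerplanar R G)
    (G_not_C5 : ~ graph_iso G C5) :
  pcf_degree_choosable 2 G.
Proof.
move=> L L_large.
have /choice[S SP] : forall v, exists s : seq color,
    [/\ uniq s, size s = (degree v).+2 & forall x, x \in s -> L v x].
  by move=> v; apply: sublist_of_card; rewrite -addn2.
have [v|v|psi [psiS psi_prop psi_cf]] := @list_colorable G _ S
  (outerplanar_theta_free G_outerplanar) (outerplanar_K4_free G_outerplanar)
  _ _ (connected_in_graph G_connected) G_not_C5.
- by have [] := SP v.
- by have [] := SP v.
exists psi; last by move=> v; have [_ _] := SP v; apply.
split=> [u v uv|v dv]; first exact/eqP/psi_prop.
exact/conflict_free_at_card/psi_cf.
Qed.
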